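(* For all $n\ge1$, $$(-1)^{n-1}M_{P_n}(\mathbf x)=\omega\,PF_{n-1}(\mathbf x),$$ where $P_n$ is the path graph on $[n]$, $M_{P_n}$ is its Möbius symmetric function, $PF_{n-1}$ is the parking function symmetric function, and $\omega$ is the standard involution on the ring of symmetric functions sending $h_m$ to $e_m$ for all $m$.
   Context: $[n]=\{1,\dots,n\}$, and $P_n$ is the graph on $[n]$ with edge set $\{\{i,i+1\}: i\in[n-1]\}$. A parking function on $[n]$ is a sequence $(p_1,\dots,p_n)\in[n]^n$ whose weakly increasing rearrangement $q_1\le\dots\le q_n$ satisfies $q_i\le i$ for all $i$. $PF_n(\mathbf x)$ is the Frobenius characteristic of the permutation representation of $\mathfrak S_n$ on the set of parking functions on $[n]$, acting by permuting entries; $PF_0=1$. A weak composition of $m\ge 0$ is an infinite sequence $\nu=(\nu(1),\nu(2),\dots)$ of nonnegative integers with sum $m$; $\mathrm{WComp}_m$ is the set of these. Weak compositions are added and compared ($\nu\ge\mu$) componentwise. An $\infty$-weighted partition of a finite set $S$ is a set $\boldsymbol\pi=\{B_1^{\nu_1},\dots,B_k^{\nu_k}\}$ where $\{B_1,\dots,B_k\}$ is a partition of $S$ and $\nu_i\in\mathrm{WComp}_{|B_i|-1}$ for all $i$. The poset $\Pi_S^\infty$ of all such has order $\{A_1^{\mu_1},\dots,A_j^{\mu_j}\}\le\{B_1^{\nu_1},\dots,B_k^{\nu_k}\}$ iff $\{A_1,\dots,A_j\}$ refines $\{B_1,\dots,B_k\}$ and, whenever $B_m=A_{i_1}\cup\dots\cup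 A_{i_l}$, one has $\nu_m\ge\mu_{i_1}+\dots+\mu_{i_l}$. For a graph $G=(V,E)$, $\Pi_G^\infty$ is the induced subposet of $\Pi_V^\infty$ of those $\boldsymbol\pi$ each of whose blocks induces a connected subgraph of $G$. Its minimum element $\hat 0$ has all blocks singletons of weight $(0,0,\dots)$; all closed intervals are finite. For connected $G$, the maximal elements are $\{V^\nu\}$ with $\nu\in\mathrm{WComp}_{|V|-1}$, and the Möbius symmetric function of $G$ in variables $\mathbf x=(x_1,x_2,\dots)$ is $$M_G(\mathbf x)=\sum_{\nu\in\mathrm{WComp}_{|V|-1}}\mu_{\Pi_G^\infty}(\hat 0,\{V^\nu\})\,\mathbf x^\nu,\qquad \mathbf x^\nu=x_1^{\nu(1)}x_2^{\nu(2)}\cdots,$$ where $\mu_P$ is the Möbius function of a poset $P$. *)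

(* Defs.v *)
From HB Require Import structures.
From mathcomp Require Import finmap.
From mathcomp Require Import boolp classical_sets functions cardinality.
From mathcomp Require Import all_boot all_order all_algebra all_fingroup.
From mathcomp Require Import all_character monalg.

Set Implicit Arguments.
Unset Strict Implicit.
Unset Printing Implicit Defensive.

Import Order.TTheory GRing.Theory Num.Theory.

Local Open Scope ring_scope.
Local Arguments mmul : simpl never.
Local Arguments mone : simpl never.

(* Weak compositions, i.e. finitely supported maps [nat -> nat], which are also
   the exponents of the monomials in the variables.  Indices start at 0, so
   that [nu i] stands for nu(i+1). *)
Notation wcomp := {cmonom nat}.

Definition wcomp_le (m1 m2 : wcomp) : bool :=
  all (fun i => m1 i <= m2 i)%N (enum_fset (finsupp m1)).

Lemma wcomp_leP (m1 m2 : wcomp) : reflect (forall i, m1 i <= m2 i)%N (wcomp_le m1 m2).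
Proof.
apply: (iffP allP) => [le12 i | le12 i _]; last exact: le12.
by case: (mdomP m1 i) => // /le12.
Qed.

Lemma wcompP (m1 m2 : wcomp) : (forall i, m1 i = m2 i) -> m1 = m2.
Proof. by move=> h; apply/eqP/cmP. Qed.

Lemma wcomp_prodE (I : Type) (r : seq I) (P : pred I) (F : I -> wcomp) i :
  (\big[mmul/mone]_(x <- r | P x) F x) i = (\sum_(x <- r | P x) F x i)%N.
Proof.
elim/big_rec2: _ => [|x _ y _ <-]; first by rewrite cm1.
by rewrite cmM.
Qed.

Lemma leq_mdeg (m : wcomp) i : (m i <= mdeg m)%N.
Proof.
case: (mdomP m i) => // im; rewrite mdegE (big_fsetD1 i) //=; exact: leq_addr.
Qed.

Lemma finite_wcomp_le (m : wcomp) : finite_set [set m' | wcomp_le m' m]%classic.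
Proof.
pose F (f : {ffun finsupp m -> 'I_(mdeg m).+1}) : wcomp :=
  [cmonom (if insub i is Some j then f j : nat else 0%N) | i in finsupp m]%M.
apply: (@sub_finite_set _ _ (F @` [set: _])%classic); last first.
  by apply: finite_image; exact: finite_finset.
move=> m' /= /wcomp_leP le'.
exists [ffun j => inord (m' (val j))] => //; apply: wcompP => i.
rewrite /F cmE fsfun_fun; case: ifPn => im.
  rewrite insubT ffunE /= inordK // ltnS.
  exact: leq_trans (le' i) (leq_mdeg _ _).
by have := le' i; rewrite (eqP (_ : m i == 0%N)) ?cmE_eq0 // leqn0 => /eqP.
Qed.

(* Formal power series in x_0, x_1, ... with rational coefficients. *)
Record fps := Fps { coef : wcomp -> rat }.
HB.instance Definition _ := [isNew for coef].
HB.instance Definition _ := [Choice of fps by <:].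

Lemma fpsP (f g : fps) : coef f =1 coef g -> f = g.
Proof. by case: f g => [f] [g] /= /funext ->. Qed.

Definition fps0 := Fps (fun=> 0).
Definition fps_opp f := Fps (fun nu => - coef f nu).
Definition fps_add f g := Fps (fun nu => coef f nu + coef g nu).
Definition fps_scale (c : rat) f := Fps (fun nu => c * coef f nu).

Lemma fps_addA : associative fps_add.
Proof. by move=> f g h; apply: fpsP => m /=; rewrite addrA. Qed.
Lemma fps_addC : commutative fps_add.
Proof. by move=> f g; apply: fpsP => m /=; rewrite addrC. Qed.
Lemma fps_add0 : left_id fps0 fps_add.
Proof. by move=> f; apply: fpsP => m /=; rewrite add0r. Qed.
Lemma fps_addN : left_inverse fps0 fps_opp fps_add.
Proof. by move=> f; apply: fpsP => m /=; rewrite addNr. Qed.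
HB.instance Definition _ :=
  GRing.isZmodule.Build fps fps_addA fps_addC fps_add0 fps_addN.

Lemma coefD f g nu : coef (f + g) nu = coef f nu + coef g nu.
Proof. by []. Qed.
Lemma coefN f nu : coef (- f) nu = - coef f nu.
Proof. by []. Qed.
Lemma coef0 nu : coef 0 nu = 0.
Proof. by []. Qed.

Lemma fps_scaleA a b v : fps_scale a (fps_scale b v) = fps_scale (a * b) v.
Proof. by apply: fpsP => m /=; rewrite mulrA. Qed.
Lemma fps_scale1 : left_id 1 fps_scale.
Proof. by move=> f; apply: fpsP => m /=; rewrite mul1r. Qed.
Lemma fps_scaleDr : right_distributive fps_scale +%R.
Proof. by move=> c f g; apply: fpsP => m /=; rewrite mulrDr. Qed.
Lemma fps_scaleDl v : {morph fps_scale^~ v : a b / a + b}.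
Proof. by move=> a b; apply: fpsP => m /=; rewrite mulrDl. Qed.
HB.instance Definition _ := GRing.Zmodule_isLmodule.Build rat fps
  fps_scaleA fps_scale1 fps_scaleDr fps_scaleDl.

Lemma coefZ c f nu : coef (c *: f) nu = c * coef f nu.
Proof. by []. Qed.

(* The finitely many ways of writing a monomial as a product of two others. *)
Definition splits (nu : wcomp) : {fset wcomp * wcomp} :=
  fset_set [set ab : wcomp * wcomp | mmul ab.1 ab.2 = nu]%classic.

Lemma mem_splits nu (ab : wcomp * wcomp) :
  (ab \in splits nu) = (mmul ab.1 ab.2 == nu).
Proof.
rewrite in_fset_set; last first.
  pose A := [set m' | wcomp_le m' nu]%classic.
  apply: (@sub_finite_set _ _ ((fun a => (a, divcm nu a)) @` A)%classic).
    case=> a b /= abE; exists a => [|]; rewrite /A /= -abE.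
      by apply/wcomp_leP => i; rewrite cmM leq_addr.
    by congr pair; apply: wcompP => i; rewrite divcmE cmM addKn.
  exact: finite_image (finite_wcomp_le _).
by apply/idP/eqP; rewrite classical_sets.in_setE.
Qed.

Definition fps_mul f g :=
  Fps (fun nu => \sum_(ab <- splits nu) coef f ab.1 * coef g ab.2).
Definition fps_one := Fps (fun nu => (nu == mone)%:R).

Lemma fps_mulC : commutative fps_mul.
Proof.
move=> f g; apply: fpsP => nu /=.
pose sw (ab : wcomp * wcomp) := (ab.2, ab.1).
have sw_inj : injective sw by move=> [a b] [c d] [-> ->].
rewrite (perm_big [seq sw ab | ab <- splits nu]) /=.
  by rewrite big_map; apply: eq_bigr => -[a b] _ /=; rewrite mulrC.
apply: uniq_perm; rewrite ?map_inj_uniq ?fset_uniq // => -[a b].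
rewrite -[(a, b)]/(sw (b, a)) mem_map //.
by rewrite !(mem_splits nu) /= mulmC.
Qed.

Lemma fps_mul1 : left_id fps_one fps_mul.
Proof.
move=> f; apply: fpsP => nu /=.
have nu_in : (mone, nu) \in splits nu by rewrite mem_splits /= mul1m.
rewrite (big_fsetD1 _ nu_in) /= eqxx mul1r big1_fset ?addr0 // => -[a b].
rewrite in_fsetD1 mem_splits xpair_eqE /=.
case: (eqVneq a mone) => [->|_]; last by rewrite mul0r.
by rewrite mul1m andTb => /andP[/negPf bN1 /eqP bE]; rewrite bE eqxx in bN1.
Qed.

Lemma fps_mulDl : left_distributive fps_mul +%R.
Proof.
move=> f g h; apply: fpsP => nu; rewrite coefD /= -big_split /=.
by apply: eq_bigr => ab _; rewrite mulrDl.
Qed.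

Lemma fps_mulA : associative fps_mul.
Proof.
move=> f g h; apply: fpsP => nu /=.
pose G (t : wcomp * wcomp * wcomp) := coef f t.1.1 * coef g t.1.2 * coef h t.2.
pose r1 := [seq ((p.1, q.1), q.2) | p <- splits nu, q <- splits p.2].
pose r2 := [seq ((q.1, q.2), p.2) | p <- splits nu, q <- splits p.1].
have r1E t : (t \in r1) = (mmul t.1.1 (mmul t.1.2 t.2) == nu).
  apply/allpairsPdep/idP => [[[a b] [[c d]]] |].
    by rewrite !mem_splits /= => -[/eqP<- /eqP<- ->].
  case: t => -[a b] c /= abc.
  by exists (a, mmul b c), (b, c); rewrite !mem_splits /= eqxx.
have r2E t : (t \in r2) = (mmul (mmul t.1.1 t.1.2) t.2 == nu).
  apply/allpairsPdep/idP => [[[a b] [[c d]]] |].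
    by rewrite !mem_splits /= => -[/eqP<- /eqP<- ->].
  case: t => -[a b] c /= abc.
  by exists (mmul a b, c), (a, b); rewrite !mem_splits /= eqxx.
transitivity (\sum_(t <- r1) G t).
  rewrite big_allpairs_dep; apply: eq_bigr => -[a b] _ /=.
  by rewrite big_distrr; apply: eq_bigr => -[c d] _; rewrite /G /= mulrA.
transitivity (\sum_(t <- r2) G t); last first.
  rewrite big_allpairs_dep; apply: eq_bigr => -[a b] _ /=.
  by rewrite big_distrl.
apply: perm_big; apply: uniq_perm => [||t]; last by rewrite r1E r2E mulmA.
  apply: allpairs_uniq_dep => [|p _|]; rewrite ?fset_uniq //.
  move=> x y /allpairsPdep[[a b] [[c d] [_ cd ->]]].
  move=> /allpairsPdep[[a' b'] [[c' d'] [_ cd' ->]]] /=.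
  move: cd cd'; rewrite !mem_splits /= => /eqP eb /eqP eb'.
  case=> *.
  by subst.
apply: allpairs_uniq_dep => [|p _|]; rewrite ?fset_uniq //.
move=> x y /allpairsPdep[[a b] [[c d] [_ cd ->]]].
move=> /allpairsPdep[[a' b'] [[c' d'] [_ cd' ->]]] /=.
move: cd cd'; rewrite !mem_splits /= => /eqP eb /eqP eb'.
  case=> *.
by subst.
Qed.

Lemma fps_oner_neq0 : fps_one != 0.
Proof.
apply/eqP => /(congr1 (fun f => coef f mone)) /= /eqP.
by rewrite eqxx oner_eq0.
Qed.

HB.instance Definition _ := GRing.Zmodule_isComNzRing.Build fps
  fps_mulA fps_mulC fps_mul1 fps_mulDl fps_oner_neq0.

Lemma coefM f g nu :
  coef (f * g) nu = \sum_(ab <- splits nu) coef f ab.1 * coef g ab.2.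
Proof. by []. Qed.
Lemma coef1 nu : coef 1 nu = (nu == mone)%:R.
Proof. by []. Qed.

Lemma fps_scaleAl (c : rat) (f g : fps) : c *: (f * g) = c *: f * g.
Proof.
apply: fpsP => nu; rewrite coefZ !coefM big_distrr /=.
by apply: eq_bigr => ab _; rewrite mulrA.
Qed.
HB.instance Definition _ :=
  GRing.Lmodule_isLalgebra.Build rat fps fps_scaleAl.
HB.instance Definition _ := GRing.Lalgebra_isComAlgebra.Build rat fps.

(* The ring of symmetric functions: power series of bounded degree that are
   invariant under all permutations of the variables. *)
Definition symmetric_fps (f : fps) : Prop :=
  forall (s : nat -> nat) (mu nu : wcomp),
    bijective s -> (forall i, mu (s i) = nu i) -> coef f mu = coef f nu.

Definition bounded_fps (f : fps) : Prop :=
  exists d, forall nu : wcomp, (d < mdeg nu)%N -> coef f nu = 0.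

Definition symf_pred : {pred fps} :=
  fun f => `[< symmetric_fps f /\ bounded_fps f >].

Section Permute.
Variables (s t : nat -> nat).
Hypotheses (stK : cancel s t) (tsK : cancel t s).

Definition wcomp_perm (m : wcomp) : wcomp :=
  [cmonom m (s i) | i in [fset t j | j in finsupp m]%fset]%M.

Lemma wcomp_permE m i : wcomp_perm m i = m (s i).
Proof.
rewrite /wcomp_perm cmE fsfun_fun; case: ifPn => // it.
case: (mdomP m (s i)) => // si; case/negP: it.
by apply/imfsetP; exists (s i); rewrite ?stK.
Qed.
End Permute.

Lemma wcomp_permK s t : cancel s t -> cancel t s ->
  cancel (wcomp_perm s t) (wcomp_perm t s).
Proof.
by move=> stK tsK m; apply: wcompP => i; rewrite !wcomp_permE // tsK.
Qed.

Lemma wcomp_permM s t a b : cancel s t -> cancel t s ->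
  wcomp_perm s t (mmul a b) = mmul (wcomp_perm s t a) (wcomp_perm s t b).
Proof.
by move=> stK tsK; apply: wcompP => i; rewrite !(wcomp_permE, cmM).
Qed.

Lemma finsupp_perm (s : nat -> nat) (mu nu : wcomp) :
  bijective s -> (forall i, mu (s i) = nu i) ->
  finsupp mu = [fset s i | i in finsupp nu]%fset.
Proof.
case=> t stK tsK munu; apply/fsetP => j.
apply/idP/imfsetP => [jmu | [i inu ->]].
  by exists (t j); rewrite /= ?tsK // -cmE_neq0 -munu tsK cmE_neq0.
by rewrite -cmE_neq0 munu cmE_neq0.
Qed.

Lemma mdeg_perm (s : nat -> nat) (mu nu : wcomp) :
  bijective s -> (forall i, mu (s i) = nu i) -> mdeg mu = mdeg nu.
Proof.
move=> sbij munu; rewrite !mdegE (finsupp_perm sbij munu).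
rewrite big_imfset /=; last exact: in2W (bij_inj sbij).
by apply: eq_bigr => i _; rewrite munu.
Qed.

Lemma symf_predP f : reflect (symmetric_fps f /\ bounded_fps f) (f \in symf_pred).
Proof. exact: asboolP. Qed.

Lemma symf_pred_closed : subalg_closed symf_pred.
Proof.
split=> [|c f g /symf_predP[fS [df fB]] /symf_predP[gS [dg gB]]
  |f g /symf_predP[fS [df fB]] /symf_predP[gS [dg gB]]]; apply/symf_predP.
- split=> [s mu nu sbij munu | ].
    by rewrite !coef1 -!mdeg_eq0 (mdeg_perm sbij munu).
  by exists 0%N => nu nu0; rewrite coef1 -mdeg_eq0 eqn0Ngt nu0.
- split=> [s mu nu sbij munu | ].
    by rewrite !coefD !coefZ (fS _ _ _ sbij munu) (gS _ _ _ sbij munu).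
  exists (maxn df dg) => nu; rewrite gtn_max => /andP[fnu gnu].
  by rewrite coefD coefZ fB // gB // mulr0 addr0.
- split=> [s mu nu sbij munu | ].
    have [t stK tsK] := sbij.
    pose P (ab : wcomp * wcomp) := (wcomp_perm s t ab.1, wcomp_perm s t ab.2).
    have Pinj : injective P.
      by move=> [a b] [c d] [] /(can_inj (wcomp_permK stK tsK)) ->
        /(can_inj (wcomp_permK stK tsK)) ->.
    have nuE : nu = wcomp_perm s t mu.
      by apply: wcompP => i; rewrite wcomp_permE.
    rewrite !coefM [RHS](perm_big [seq P ab | ab <- splits mu]) /=.
      rewrite big_map; apply: eq_bigr => -[a b] _ /=.
      congr (_ * _); [apply: (fS s) | apply: (gS s)] => // i;
        by rewrite wcomp_permE.
    apply: uniq_perm; rewrite ?map_inj_uniq ?fset_uniq // => -[a b].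
    have -> : (a, b) = P (wcomp_perm t s a, wcomp_perm t s b).
      by rewrite /P /= !(wcomp_permK tsK stK).
    rewrite mem_map // !mem_splits nuE -wcomp_permM //.
    by rewrite (inj_eq (can_inj (wcomp_permK stK tsK))).
  exists (df + dg)%N => nu lt_nu; rewrite coefM big1_seq // => -[a b] /=.
  rewrite mem_splits /= => /eqP abE; move: lt_nu; rewrite -abE mdegM => lt_ab.
  have [/fB ->|le_a] := ltnP df (mdeg a); first by rewrite mul0r.
  have [/gB ->|le_b] := ltnP dg (mdeg b); first by rewrite mulr0.
  by have := leq_trans lt_ab (leq_add le_a le_b); rewrite ltnn.
Qed.

HB.instance Definition _ := GRing.isSubalgClosed.Build rat fps symf_pred
  symf_pred_closed.

Record symf := Symf { symf_val :> fps; _ : symf_val \in symf_pred }.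
HB.instance Definition _ := [isSub for symf_val].
HB.instance Definition _ := [Choice of symf by <:].
HB.instance Definition _ := [SubChoice_isSubAlgebra of symf by <:].
HB.instance Definition _ := [SubNzRing_isSubComNzRing of symf by <:].

Lemma symf_indicator (b : pred wcomp) d :
    (forall (s : nat -> nat) (mu nu : wcomp), bijective s ->
       (forall i, mu (s i) = nu i) -> b mu = b nu) ->
    (forall nu, b nu -> mdeg nu = d) ->
  Fps (fun nu => (b nu)%:R) \in symf_pred.
Proof.
move=> bS bd; apply/symf_predP; split=> [s mu nu sbij munu /= | ].
  by rewrite (bS _ _ _ sbij munu).
exists d => nu /=; case: (boolP (b nu)) => // /bd ->; by rewrite ltnn.
Qed.

Definition is_monom_h (m : nat) (nu : wcomp) : bool := mdeg nu == m.

Definition is_monom_e (m : nat) (nu : wcomp) : bool :=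
  (mdeg nu == m) && all (fun i => nu i == 1%N) (enum_fset (finsupp nu)).

Definition is_monom_p (k : nat) (nu : wcomp) : bool :=
  (mdeg nu == k) && (#|` finsupp nu| == 1%N).

Lemma monom_h_subproof m : Fps (fun nu => (is_monom_h m nu)%:R) \in symf_pred.
Proof.
apply: (@symf_indicator _ m) => [s mu nu sbij munu | nu /eqP //].
by rewrite /is_monom_h (mdeg_perm sbij munu).
Qed.

Lemma monom_e_subproof m : Fps (fun nu => (is_monom_e m nu)%:R) \in symf_pred.
Proof.
apply: (@symf_indicator _ m) => [s mu nu sbij munu | nu /andP[/eqP]//].
rewrite /is_monom_e (mdeg_perm sbij munu); congr (_ && _).
rewrite (finsupp_perm sbij munu).
apply/allP/allP => [h i inu | h _ /imfsetP[i /= inu ->]].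
  by rewrite -munu h //; apply/imfsetP; exists i.
by rewrite munu h.
Qed.

Lemma monom_p_subproof k : Fps (fun nu => (is_monom_p k nu)%:R) \in symf_pred.
Proof.
apply: (@symf_indicator _ k) => [s mu nu sbij munu | nu /andP[/eqP]//].
rewrite /is_monom_p (mdeg_perm sbij munu) (finsupp_perm sbij munu).
by rewrite card_imfset //; exact: bij_inj.
Qed.

(* The complete homogeneous (all monomials of degree m), elementary (squarefree
   ones) and power sum (powers x_i^k of a variable) symmetric functions;
   [symf_p k] is only meaningful for k >= 1. *)
Definition symf_h m : symf := Symf (monom_h_subproof m).
Definition symf_e m : symf := Symf (monom_e_subproof m).
Definition symf_p k : symf := Symf (monom_p_subproof k).

(* Frobenius characteristic of a representation of the symmetric group: the
   sum of chi(w) p_{cycle type of w} over all w, divided by n!. *)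
Definition frobenius_char n d
    (rG : mx_representation rat [set: 'S_n] d) : symf :=
  (n`!%:R)^-1 *: \sum_(w : 'S_n)
     \tr (rG w) *: \prod_(c in porbits w) symf_p #|c|.

(* Linearisation of an action on a finite set. *)
Section PermutationRepresentation.
Variables (gT : finGroupType) (T : finType) (to : {action gT &-> T}).

Definition perm_repr_mx (g : gT) : 'M[rat]_#|T| :=
  \matrix_(i, j) (to (enum_val i) g == enum_val j)%:R.

Lemma perm_repr_subproof : mx_repr [set: gT] perm_repr_mx.
Proof.
split=> [|g h _ _]; apply/matrixP => i j; rewrite !mxE.
  by rewrite act1 (inj_eq enum_val_inj).
rewrite actM (bigD1 (enum_rank (to (enum_val i) g))) //= !mxE enum_rankK eqxx.
rewrite mul1r big1 ?addr0 // => k kN; rewrite !mxE.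
case: eqVneq => [e|_]; last by rewrite mul0r.
by rewrite e enum_valK eqxx in kN.
Qed.

Definition perm_repr := MxRepresentation perm_repr_subproof.
End PermutationRepresentation.

(* A sequence (p_1, ..., p_n) in [n]^n is represented by the function
   i |-> p_{i+1} - 1 on 'I_n. *)
Definition is_parking n (f : {ffun 'I_n -> 'I_n}) : bool :=
  [forall i : 'I_n, nth 0 (sort leq [seq (f j).+1 | j : 'I_n]) i <= i.+1]%N.

Record parking n :=
  Parking { parking_val :> {ffun 'I_n -> 'I_n}; _ : is_parking parking_val }.
HB.instance Definition _ n := [isSub for @parking_val n].
HB.instance Definition _ n := [Finite of parking n by <:].

Section ParkingAction.
Variable n : nat.

Definition ffun_perm (f : {ffun 'I_n -> 'I_n}) (w : 'S_n) :
  {ffun 'I_n -> 'I_n} := [ffun i => f ((w^-1)%g i)].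

Lemma is_parking_perm f w : is_parking f -> is_parking (ffun_perm f w).
Proof.
rewrite /is_parking => pf.
suff -> : sort leq [seq (ffun_perm f w j).+1 | j : 'I_n]
        = sort leq [seq (f j).+1 | j : 'I_n] by [].
apply/perm_sortP; [exact: leq_total|exact: leq_trans|exact: anti_leq|].
have -> : [seq (ffun_perm f w j).+1 | j : 'I_n]
        = [seq (f j).+1 | j <- [seq (w^-1)%g i | i : 'I_n]].
  rewrite -map_comp; apply: (@eq_map _ _ (fun j => (ffun_perm f w j).+1)) => j.
  by rewrite ffunE.
apply: (perm_map (fun j => (f j).+1)); apply: uniq_perm.
- by rewrite map_inj_uniq ?enum_uniq //; exact: perm_inj.
- exact: enum_uniq.
move=> i; rewrite mem_enum; apply/mapP; exists (w i); rewrite ?mem_enum //.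
by rewrite permK.
Qed.

Definition parking_perm (p : parking n) (w : 'S_n) : parking n :=
  Parking (is_parking_perm w (valP p)).

Lemma parking_perm1 : parking_perm^~ 1%g =1 id.
Proof.
by move=> p; apply/val_inj/ffunP => i /=; rewrite ffunE invg1 perm1.
Qed.

Lemma parking_permM p : act_morph parking_perm p.
Proof.
move=> v w; apply/val_inj/ffunP => i /=.
by rewrite !ffunE invMg permM.
Qed.

Definition parking_action := TotalAction parking_perm1 parking_permM.
End ParkingAction.

Definition PFsym n : symf := frobenius_char (perm_repr (parking_action n)).

(* The Moebius function of a locally finite poset, by recursion on the size of
   the interval; see [mobiusE].  Note that [fset_set] of an infinite set is
   empty. *)
Section Mobius.
Context {d : Order.disp_t} {T : porderType d}.

Definition itv_fset (x y : T) : {fset T} :=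
  fset_set [set z : T | (x <= z <= y)%O]%classic.

Fixpoint mobius_rec (k : nat) (x y : T) : int :=
  if x == y then 1 else
  if k is k'.+1 then - \sum_(z <- itv_fset x y | z != y) mobius_rec k' x z
  else 0.

Definition mobius (x y : T) : int := mobius_rec #|` itv_fset x y| x y.

Hypothesis finT : forall x y : T, finite_set [set z : T | (x <= z <= y)%O]%classic.

Lemma mem_itv_fset x y z : (z \in itv_fset x y) = (x <= z <= y)%O.
Proof. by rewrite in_fset_set //; apply/idP/idP; rewrite classical_sets.in_setE. Qed.

Lemma card_itv_fset_lt x y z :
  z \in itv_fset x y -> z != y -> (#|` itv_fset x z| < #|` itv_fset x y|)%N.
Proof.
rewrite mem_itv_fset => /andP[xz zy] zNy; apply: fproper_ltn_card.
rewrite fproperE; apply/andP; split.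
  apply/fsubsetP => t; rewrite !mem_itv_fset => /andP[-> tz].
  exact: le_trans tz zy.
apply/fsubsetPn; exists y; first by rewrite mem_itv_fset (le_trans xz zy) lexx.
rewrite mem_itv_fset (le_trans xz zy) /=; apply: contraNN zNy => yz.
by rewrite eq_le zy.
Qed.

Lemma mobius_recE k x y :
  (#|` itv_fset x y| <= k)%N -> mobius_rec k x y = mobius x y.
Proof.
rewrite /mobius; have [m] := ubnP #|` itv_fset x y|.
elim: m k y => // m IHm k y; rewrite ltnS => le_m le_k.
case: (eqVneq x y) => [->|xNy].
  by case: k {le_k} => [|k]; case: #|` _| => [|l] /=; rewrite eqxx.
case Ec: #|` itv_fset x y| le_m le_k => [|l].
  move/eqP: Ec; rewrite cardfs_eq0 => /eqP itv0 _ _.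
  case: k => [|k] //=; rewrite (negPf xNy) // itv0 big_seq_cond.
  by rewrite big_pred0 ?oppr0 // => z; rewrite in_fset0.
case: m IHm => // m IHm; case: k => // k; rewrite !ltnS => le_l le_k /=.
rewrite (negPf xNy); congr (- _).
rewrite big_seq_cond [RHS]big_seq_cond; apply: eq_bigr => z /andP[zI zNy].
have := card_itv_fset_lt zI zNy; rewrite Ec ltnS => le_zl.
by rewrite !IHm // ?ltnS (leq_trans le_zl).
Qed.

Lemma mobiusE x y :
  mobius x y = if x == y then 1 else - \sum_(z <- itv_fset x y | z != y) mobius x z.
Proof.
rewrite -[LHS](mobius_recE (leqnSn _)) /=; case: eqP => // _; congr (- _).
rewrite big_seq_cond [RHS]big_seq_cond; apply: eq_bigr => z /andP[zI zNy].
by rewrite mobius_recE // ltnW // card_itv_fset_lt.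
Qed.

Lemma mobius_sum0 x y : (x < y)%O -> \sum_(z <- itv_fset x y) mobius x z = 0.
Proof.
move=> xy; have yI : y \in itv_fset x y by rewrite mem_itv_fset lexx ltW.
rewrite (big_fsetD1 y yI) /= mobiusE lt_eqF //.
apply/eqP; rewrite addrC subr_eq0; apply/eqP.
rewrite big_seq_cond [RHS]big_seq_cond -[LHS]big_filter -[RHS]big_filter.
apply: perm_big; apply: uniq_perm; rewrite ?filter_uniq ?fset_uniq // => z.
by rewrite !mem_filter in_fsetD1; case: (z \in itv_fset x y); case: (z != y).
Qed.
End Mobius.

(* An infinity-weighted partition of the finite set [T] is given by its set of
   blocks and the weight of each block; weights outside the set of blocks are
   forced to be zero, so that equality is Leibniz equality. *)
Definition wpart_data (T : finType) : Type :=
  {set {set T}} * {ffun {set T} -> wcomp}.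
HB.instance Definition _ (T : finType) := Choice.on (wpart_data T).

Definition is_wpart (T : finType) (p : wpart_data T) : bool :=
  [&& partition p.1 [set: T],
      [forall B in p.1, mdeg (p.2 B) == #|B|.-1]
    & [forall B, (B \notin p.1) ==> (p.2 B == mone)]].

Record wpart (T : finType) :=
  WPart { wpart_val : wpart_data T; _ : is_wpart wpart_val }.
HB.instance Definition _ T := [isSub for @wpart_val T].
HB.instance Definition _ T := [Choice of wpart T by <:].

Definition blocks T (pi : wpart T) : {set {set T}} := (wpart_val pi).1.
Definition weight T (pi : wpart T) (B : {set T}) : wcomp := (wpart_val pi).2 B.

(* [mmul] is the componentwise addition of weak compositions. *)
Definition wpart_le T (pi rho : wpart T) : bool :=
  [forall A in blocks pi, [exists B in blocks rho, A \subset B]] &&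
  [forall B in blocks rho,
     wcomp_le (\big[mmul/mone]_(A in blocks pi | A \subset B) weight pi A)
              (weight rho B)].

Section WPartOrder.
Variable T : finType.
Implicit Types pi rho sigma : wpart T.

Lemma wpart_partition pi : partition (blocks pi) [set: T].
Proof. by case/and3P: (valP pi). Qed.

Lemma wpart_weight0 pi B : B \notin blocks pi -> weight pi B = mone.
Proof. by case/and3P: (valP pi) => _ _ /forallP/(_ B)/implyP h /h/eqP. Qed.

Lemma wpart_block_neq0 pi B : B \in blocks pi -> B != set0.
Proof.
case/and3P: (wpart_partition pi) => _ _ N0 BP.
by apply: contraNneq N0 => <-.
Qed.

Lemma wpart_block_sub pi A B : A \in blocks pi -> B \in blocks pi ->
  forall C : {set T}, C != set0 -> C \subset A -> C \subset B -> A = B.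
Proof.
case/and3P: (wpart_partition pi) => _ /trivIsetP tI _ AP BP C C0 CA CB.
apply/eqP; apply: contraT => /(tI _ _ AP BP) /disjoint_setI0 AB0.
by move: C0; rewrite -subset0 -AB0 subsetI CA CB.
Qed.

Lemma wpart_leP pi rho : reflect
  ((forall A, A \in blocks pi -> exists2 B, B \in blocks rho & A \subset B) /\
   (forall B, B \in blocks rho -> forall i,
     (\sum_(A in blocks pi | A \subset B) weight pi A i <= weight rho B i)%N))
  (wpart_le pi rho).
Proof.
apply: (iffP andP) => -[h1 h2]; split.
- move=> A AP; move/forall_inP: h1 => /(_ A AP) /exists_inP[B BP AB].
  by exists B.
- move=> B BP i; move/forall_inP: h2 => /(_ B BP) /wcomp_leP/(_ i).
  by rewrite wcomp_prodE.
- by apply/forall_inP => A /h1[B BP AB]; apply/exists_inP; exists B.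
- apply/forall_inP => B /h2 h; apply/wcomp_leP => i.
  by rewrite wcomp_prodE.
Qed.

Lemma wpart_sum_same pi B i : B \in blocks pi ->
  (\sum_(A in blocks pi | A \subset B) weight pi A i = weight pi B i)%N.
Proof.
move=> BP; rewrite (bigD1 B) ?BP ?subxx //= big1 ?addn0 // => A.
case/andP=> /andP[AP AB] /eqP; case.
exact: wpart_block_sub AP BP _ (wpart_block_neq0 AP) (subxx _) AB.
Qed.

Lemma wpart_le_refl : reflexive (@wpart_le T).
Proof.
move=> pi; apply/wpart_leP; split=> [A AP|B BP i]; first by exists A.
by rewrite wpart_sum_same.
Qed.

Lemma wpart_le_blocks pi rho :
  wpart_le pi rho -> wpart_le rho pi -> {subset blocks pi <= blocks rho}.
Proof.
move=> /wpart_leP[h1 _] /wpart_leP[h2 _] A AP.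
have [B BP AB] := h1 A AP; have [C CP BC] := h2 B BP.
have AC : A = C.
  apply: wpart_block_sub AP CP _ (wpart_block_neq0 AP) (subxx _) _.
  exact: subset_trans BC.
suff -> : A = B by [].
by apply/eqP; rewrite eqEsubset AB AC.
Qed.

Lemma wpart_le_anti : antisymmetric (@wpart_le T).
Proof.
move=> pi rho /andP[le1 le2].
have bE : blocks pi = blocks rho.
  by apply/setP => A; apply/idP/idP; apply: wpart_le_blocks.
apply: val_inj; rewrite [LHS]surjective_pairing [RHS]surjective_pairing.
congr pair; first exact: bE.
apply/ffunP => B; rewrite -[LHS]/(weight pi B) -[RHS]/(weight rho B).
have [BP|BN] := boolP (B \in blocks pi); last first.
  by rewrite !wpart_weight0 // -bE.
have BR : B \in blocks rho by rewrite -bE.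
move/wpart_leP: le1 => [_ /(_ B BR) le1].
move/wpart_leP: le2 => [_ /(_ B BP) le2].
apply: wcompP => i; apply/eqP; rewrite eqn_leq.
by rewrite -{1}(wpart_sum_same i BP) le1 -(wpart_sum_same i BR) le2.
Qed.

Lemma wpart_le_trans : transitive (@wpart_le T).
Proof.
move=> rho pi sigma /wpart_leP[h1 w1] /wpart_leP[h2 w2]; apply/wpart_leP.
split=> [A AP|C CP i].
  have [B BP AB] := h1 A AP; have [C CP BC] := h2 B BP.
  by exists C => //; exact: subset_trans BC.
apply: leq_trans (w2 C CP i).
apply: (@leq_trans (\sum_(B in blocks rho | B \subset C)
    \sum_(A in blocks pi | A \subset B) weight pi A i)); last first.
  by apply: leq_sum => B /andP[BP _]; exact: w1.
rewrite (exchange_big_dep (fun A => A \in blocks pi)) /=; last first.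
  by move=> B A _ /andP[].
rewrite [leqLHS]big_mkcondr /=; apply: leq_sum => A AP.
case: ifP => // AC; have [B BP AB] := h1 A AP; have [C' CP' BC'] := h2 B BP.
have CC' : C = C'.
  apply: wpart_block_sub CP CP' _ (wpart_block_neq0 AP) AC _.
  exact: subset_trans BC'.
rewrite (bigD1 B) /=; first exact: leq_addr.
by rewrite BP CC' BC' AP AB.
Qed.
End WPartOrder.

Fact wpart_display : Order.disp_t. Proof. by []. Qed.
HB.instance Definition _ (T : finType) := Order.Le_isPOrder.Build wpart_display
  (wpart T) (@wpart_le_refl T) (@wpart_le_anti T) (@wpart_le_trans T).

(* Finite simple graphs. *)
Record sgraph := SGraph {
  vertex :> finType;
  edge : rel vertex;
  edge_sym : symmetric edge;
  edge_irr : irreflexive edge }.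

Section BondPoset.
Variable G : sgraph.

Definition connected_in (B : {set G}) : bool :=
  [forall x in B, forall y in B,
     connect [rel u v | [&& u \in B, v \in B & edge u v]] x y].

(* The poset of infinity-weighted partitions of the vertices of [G] all of
   whose blocks are connected. *)
Record gpart := GPart {
  gpart_val :> wpart G;
  _ : [forall B in blocks gpart_val, connected_in B] }.
HB.instance Definition _ := [isSub for gpart_val].
HB.instance Definition _ := [Choice of gpart by <:].
HB.instance Definition _ :=
  [SubChoice_isSubPOrder of gpart by <: with wpart_display].

Lemma finite_gpart_itv (x y : gpart) :
  finite_set [set z : gpart | (x <= z <= y)%O]%classic.
Proof.
pose N : wcomp := \big[mmul/mone]_(B in blocks y) weight y B.
pose S := enum_fset (fset_set [set m | wcomp_le m N]%classic).
have inS m : (m \in S) = wcomp_le m N.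
  rewrite (in_fset_set (finite_wcomp_le N)); apply/idP/idP; by rewrite classical_sets.in_setE.
pose F (p : {set {set G}} * {ffun {set G} -> seq_sub S}) : wpart_data G :=
  (p.1, [ffun B => val (p.2 B)]).
pose f (z : gpart) : wpart_data G := val (val z).
apply: (@sub_finite_set _ _ (f @^-1` (F @` [set: _]))%classic); last first.
  apply: finite_preimage; first by move=> a b _ _ /val_inj/val_inj.
  by apply: finite_image; exact: finite_finset.
move=> z /= /andP[_ /wpart_leP[h1 h2]].
have leN B : weight z B \in S.
  rewrite inS; apply/wcomp_leP => i.
  have [BP|BN] := boolP (B \in blocks z); last by rewrite wpart_weight0 // cm1.
  have [C CP BC] := h1 B BP.
  rewrite /N wcomp_prodE (bigD1 C) //=; apply: leq_trans (leq_addr _ _).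
  by apply: leq_trans (h2 C CP i); rewrite (bigD1 B) ?BP //= leq_addr.
exists (blocks z, [ffun B => SeqSub (leN B)]) => //.
rewrite /F /f [RHS]surjective_pairing /=; congr pair.
by apply/ffunP => B; rewrite !ffunE.
Qed.

Definition hat0_data : wpart_data G :=
  ([set [set x] | x in [set: G]], [ffun=> mone]).

Lemma hat0_is_wpart : is_wpart hat0_data.
Proof.
apply/and3P; split=> /=; last 2 first.
- by apply/forall_inP => B /imsetP[x _ ->]; rewrite ffunE mdeg1 cards1.
- by apply/forall_inP => B _; rewrite ffunE.
apply/and3P; split.
- apply/eqP/setP => x; rewrite inE; apply/bigcupP.
  by exists [set x]; rewrite ?inE //; apply/imsetP; exists x.
- apply/trivIsetP => _ _ /imsetP[x _ ->] /imsetP[y _ ->] xy.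
  rewrite disjoints1 inE; by apply: contraNneq xy => ->.
- by apply/imsetP => -[x _] /setP/(_ x); rewrite !inE eqxx.
Qed.

Lemma hat0_connected :
  [forall B in blocks (WPart hat0_is_wpart), connected_in B].
Proof.
apply/forall_inP => _ /imsetP[x _ ->].
by do 2!(apply/forall_inP => ? /set1P ->).
Qed.

Definition hat0 : gpart := GPart hat0_connected.

Lemma hat0_le (pi : gpart) : (hat0 <= pi)%O.
Proof.
apply/wpart_leP; split=> [_ /imsetP[x _ ->]|B BP i].
  have /and3P[/eqP covE _ _] := wpart_partition pi.
  have : x \in cover (blocks pi) by rewrite covE inE.
  by case/bigcupP => B BP xB; exists B; rewrite ?sub1set.
by rewrite big1 // => A _; rewrite /weight /= ffunE cm1.
Qed.

(* The one-block partition {V^nu}, if it belongs to the poset: for connected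
   [G] this means that [nu] is a weak composition of |V| - 1. *)
Definition one_block (nu : wcomp) : option gpart :=
  let p : wpart_data G :=
    ([set [set: G]], [ffun B => if B == [set: G] then nu else mone]) in
  obind insub (insub p : option (wpart G)).

Lemma one_blockE (nu : wcomp) :
  one_block nu = [&& (0 < #|G|)%N, connected_in [set: G]
                   & mdeg nu == #|G|.-1] :> bool.
Proof.
rewrite /one_block.
set p : wpart_data G := (_, _).
have pE : is_wpart p = (0 < #|G|)%N && (mdeg nu == #|G|.-1).
  have fT : [forall B in p.1, mdeg (p.2 B) == #|B|.-1] = (mdeg nu == #|G|.-1).
    apply/forall_inP/idP => [/(_ setT)|nuG B /set1P ->].
      by rewrite inE ffunE eqxx cardsT => ->.
    by rewrite ffunE eqxx cardsT.
  have f0 : [forall B, (B \notin p.1) ==> (p.2 B == mone)].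
    by apply/forall_inP => B; rewrite inE ffunE => /negPf ->.
  rewrite /is_wpart fT f0 andbT; congr (_ && _).
  rewrite /partition /cover big_set1 eqxx inE /=.
  have -> : trivIset p.1.
    by apply/trivIsetP => A B /set1P -> /set1P ->; rewrite eqxx.
  by rewrite eq_sym -card_gt0 cardsT.
case: insubP => [pi piP piE|]; last first.
  by rewrite pE negb_and => /orP[] /negPf -> //=; rewrite !andbF.
move: piP; rewrite pE => /andP[-> ->] /=; rewrite andbT.
have bE : blocks pi = [set [set: G]] by rewrite /blocks piE.
case: insubP => [q qP _|/negPf qN] /=.
  by move/forall_inP: qP => /(_ setT) ->; rewrite // bE inE.
symmetry; apply/negbTE; apply: contraFN qN => GT.
by apply/forall_inP => B; rewrite bE => /set1P ->.
Qed.

(* The Moebius symmetric function of a connected graph, as a power series. *)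
Definition mobius_sym : fps :=
  Fps (fun nu => if one_block nu is Some top then (mobius hat0 top)%:~R else 0).
End BondPoset.

Section PathGraph.
Variable n : nat.

(* The vertex [i : 'I_n] stands for i + 1. *)
Definition path_edge : rel 'I_n :=
  [rel i j : 'I_n | (i.+1 == j :> nat) || (j.+1 == i :> nat)].

Lemma path_edge_sym : symmetric path_edge.
Proof. by move=> i j; exact: orbC. Qed.

Lemma path_edge_irr : irreflexive path_edge.
Proof. by move=> i; rewrite /path_edge /= orbb gtn_eqF. Qed.

Definition path_graph : sgraph := SGraph path_edge_sym path_edge_irr.
End PathGraph.

(* Main.v *)
(** Dually to its usual recursion, the Moebius function [mu(-, top)] is the only
function whose sums over all upper intervals [[x, top]] vanish, except for
[x = top]. With [top = {[n]^nu}], an element [y] of [[x, top]] is an interval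
partition [Y] coarser than that of [x] together with, for each block [B] of [Y],
an extra weight of degree [c_B - 1], where [B] contains [c_B] blocks of [x]. Hence
if [mu(y, top)] is the coefficient of [nu / (total weight of y)] in a series
[M_l], where [l] is the number of blocks of [y], then the condition reads
[sum_l M_l [t^k] (t H(t))^l = [k = 1]], where [H = sum_m h_m t^m]. As
[H(t) E(-t) = 1], it is solved by [(-1)^(l-1)] times the generating function of
plane trees with [l] nodes, in which a node with [j] children has weight [e_j].

On the other side, the coefficient of [nu] in [PF_n] counts, by Burnside's lemma,
the orbits on pairs of a parking function and a colouring of [n] with content
[nu]. An orbit is determined by the contents of the fibres of the parking
function, so [PF_n] is the sum of the products [h_(a_1) ... h_(a_n)] over the fibre
sizes of parking functions. These are the Lukasiewicz words of plane trees with
[n + 1] nodes (without the final 0), and [omega] turns each [h] into [e]. *)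

Require Import Defs.
From mathcomp Require Import finmap.
From mathcomp Require Import boolp classical_sets functions cardinality.
From mathcomp Require Import all_boot all_order all_algebra all_fingroup.
From mathcomp Require Import all_character monalg ring.

Set Implicit Arguments.
Unset Strict Implicit.
Unset Printing Implicit Defensive.

Import Order.TTheory GRing.Theory Num.Theory.

Local Open Scope ring_scope.

Local Arguments mmul : simpl never.
Local Arguments mone : simpl never.

(** * Coefficients of products of power series *)

Lemma wcomp_le_refl (a : wcomp) : wcomp_le a a.
Proof. by apply/wcomp_leP. Qed.

Lemma wcomp_le_trans (b a c : wcomp) : wcomp_le a b -> wcomp_le b c -> wcomp_le a c.
Proof.
move=> /wcomp_leP ab /wcomp_leP bc; apply/wcomp_leP => i.
exact: leq_trans (ab i) (bc i).
Qed.

Lemma wcomp_le_mull (a b : wcomp) : wcomp_le a (mmul a b).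
Proof. by apply/wcomp_leP => i; rewrite cmM leq_addr. Qed.

Lemma wcomp_le_mulr (a b : wcomp) : wcomp_le b (mmul a b).
Proof. by rewrite mulmC wcomp_le_mull. Qed.

Lemma wcomp_le1 (a : wcomp) : wcomp_le a mone = (a == mone).
Proof.
apply/idP/eqP => [/wcomp_leP h|->]; last exact: wcomp_le_refl.
by apply: wcompP => i; apply/eqP; rewrite cm1 -leqn0 -{2}(cm1 i) h.
Qed.

Lemma divcmK (a b : wcomp) : wcomp_le a b -> mmul a (divcm b a) = b.
Proof.
by move=> /wcomp_leP ab; apply: wcompP => i; rewrite cmM divcmE subnKC.
Qed.

Lemma divcm_mul (a b : wcomp) : divcm (mmul a b) a = b.
Proof. by apply: wcompP => i; rewrite divcmE cmM addKn. Qed.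

Lemma mmul_eq (a b c : wcomp) : (mmul a b == c) = wcomp_le a c && (b == divcm c a).
Proof.
apply/eqP/andP => [<-|[ac /eqP ->]]; last exact: divcmK.
by rewrite wcomp_le_mull divcm_mul.
Qed.

Lemma divcm_divcm (a b c : wcomp) : divcm (divcm a b) c = divcm a (mmul b c).
Proof. by apply: wcompP => i; rewrite !divcmE cmM subnDA. Qed.

Lemma mdeg_divcm (a b : wcomp) : wcomp_le a b -> mdeg (divcm b a) = (mdeg b - mdeg a)%N.
Proof. by move=> ab; rewrite -{2}(divcmK ab) mdegM addKn. Qed.

Lemma wcomp_le_deg_eq (a b : wcomp) : wcomp_le a b -> mdeg a = mdeg b -> a = b.
Proof.
move=> ab dab; have := mdeg_divcm ab; rewrite dab subnn => /eqP.
by rewrite mdeg_eq0 => /eqP d1; rewrite -(divcmK ab) d1 mulm1.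
Qed.

Lemma fps_coef_sum (I : Type) (r : seq I) (P : pred I) (F : I -> fps) nu :
  coef (\sum_(i <- r | P i) F i) nu = \sum_(i <- r | P i) coef (F i) nu.
Proof. by elim/big_rec2: _ => // i _ y _ <-; rewrite Defs.coefD. Qed.

Definition fmonom (m : wcomp) : fps := Fps (fun nu => (nu == m)%:R).

Lemma coef_fmonomM m f nu :
  coef (fmonom m * f) nu = if wcomp_le m nu then coef f (divcm nu m) else 0.
Proof.
rewrite Defs.coefM; case: ifP => mnu; last first.
  rewrite big1_seq // => -[a b] /=; rewrite mem_splits /= => /eqP ab.
  case: eqP => [am|_]; last by rewrite mul0r.
  by rewrite -ab am wcomp_le_mull in mnu.
have mem : (m, divcm nu m) \in splits nu by rewrite mem_splits /= divcmK.
rewrite (big_fsetD1 _ mem) /= eqxx mul1r big1_fset ?addr0 // => -[a b].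
rewrite in_fsetD1 mem_splits xpair_eqE /=.
case: (eqVneq a m) => [->|_]; last by rewrite mul0r.
by rewrite mmul_eq mnu andTb => /andP[/negPf ->].
Qed.

Lemma fmonomM a b : fmonom (mmul a b) = fmonom a * fmonom b.
Proof.
apply: fpsP => nu; rewrite coef_fmonomM /= [nu == _]eq_sym mmul_eq.
by case: ifP => //= _; rewrite eq_sym.
Qed.

Lemma fmonom1 : fmonom mone = 1.
Proof. exact: fpsP. Qed.

Lemma fmonom_prod (I : Type) (r : seq I) (P : pred I) (F : I -> wcomp) :
  \prod_(i <- r | P i) fmonom (F i) = fmonom (\big[mmul/mone]_(i <- r | P i) F i).
Proof. by rewrite (big_morph _ fmonomM fmonom1). Qed.

(** * Truncation of power series to the divisors of a monomial *)

Definition divisors_of (nu : wcomp) : {fset wcomp} :=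
  fset_set [set m | wcomp_le m nu]%classic.

Lemma mem_divisors_of nu m : (m \in divisors_of nu) = wcomp_le m nu.
Proof.
rewrite (in_fset_set (finite_wcomp_le nu)); apply/idP/idP;
  by rewrite classical_sets.in_setE.
Qed.

Lemma divisors_of_le nu (m : divisors_of nu) : wcomp_le (val m) nu.
Proof. by rewrite -mem_divisors_of; exact: valP. Qed.

(** Congruence modulo the monomials that do not divide [nu]. It is compatible with products, as the
    factors of a divisor of [nu] divide [nu], and it allows a series to be replaced by a finite sum
    of monomials. *)
Definition eq_below (nu : wcomp) (f g : fps) : Prop :=
  forall m, wcomp_le m nu -> coef f m = coef g m.

Lemma eq_belowM nu f1 f2 g1 g2 : eq_below nu f1 g1 -> eq_below nu f2 g2 ->
  eq_below nu (f1 * f2) (g1 * g2).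
Proof.
move=> e1 e2 m mnu; rewrite !Defs.coefM; apply: eq_big_seq => -[a b] /=.
rewrite mem_splits /= => /eqP abm.
rewrite e1 ?e2 //; apply: wcomp_le_trans mnu; rewrite -abm.
  exact: wcomp_le_mulr.
exact: wcomp_le_mull.
Qed.

Lemma eq_below_prod nu (I : Type) (r : seq I) (P : pred I) (F G : I -> fps) :
  (forall i, P i -> eq_below nu (F i) (G i)) ->
  eq_below nu (\prod_(i <- r | P i) F i) (\prod_(i <- r | P i) G i).
Proof.
by move=> FG; apply: (big_ind2 (eq_below nu)) => // *; apply: eq_belowM.
Qed.

Lemma eq_below_fmonoms nu f :
  eq_below nu f (\sum_(m : divisors_of nu) coef f (val m) *: fmonom (val m)).
Proof.
move=> m mnu; rewrite fps_coef_sum.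
have mD : m \in divisors_of nu by rewrite mem_divisors_of.
rewrite (bigD1 [` mD]%fset) //= eqxx mulr1 big1 ?addr0 // => m' m'N.
rewrite eq_sym; case: eqVneq => [e|_]; last by rewrite mulr0.
by case/eqP: m'N; apply: val_inj.
Qed.

(** Modulo the monomials that do not divide [nu], each [F i] is a finite sum, so the product expands
    over the functions [d] that choose a divisor of [nu] for each index; [f] is kept whole. *)
Lemma coef_mul_prod (I : finType) (f : fps) (F : I -> fps) nu :
  coef (f * \prod_i F i) nu =
  \sum_(d : {ffun I -> divisors_of nu}) (\prod_i coef (F i) (val (d i))) *
     (if wcomp_le (\big[mmul/mone]_i val (d i)) nu
      then coef f (divcm nu (\big[mmul/mone]_i val (d i))) else 0).
Proof.
have -> : coef (f * \prod_i F i) nu = coef (f * \prod_i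
    \sum_(m : divisors_of nu) coef (F i) (val m) *: fmonom (val m)) nu.
  apply: (@eq_belowM nu) (wcomp_le_refl nu) => //.
  by apply: eq_below_prod => i _; exact: eq_below_fmonoms.
rewrite bigA_distr_bigA mulr_sumr fps_coef_sum; apply: eq_bigr => d _.
by rewrite scaler_prod -scalerAr Defs.coefZ fmonom_prod mulrC [f * _]mulrC coef_fmonomM mulrC.
Qed.

Lemma coef_mul_prod_ind (I : finType) (f : fps) (b : I -> pred wcomp) nu :
  coef (f * \prod_i Fps (fun m => (b i m)%:R)) nu =
  \sum_(d : {ffun I -> divisors_of nu} | [forall i, b i (val (d i))] &&
     wcomp_le (\big[mmul/mone]_i val (d i)) nu)
     coef f (divcm nu (\big[mmul/mone]_i val (d i))).
Proof.
rewrite coef_mul_prod [RHS]big_mkcond; apply: eq_bigr => d _ /=.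
case: (boolP [forall i, _]) => [/forallP h|/forallPn[i /negPf h]] /=.
  by rewrite big1 ?mul1r // => i _; rewrite h.
by rewrite (bigD1 i) //= h mul0r mul0r.
Qed.

Lemma coef_prod_ind (I : finType) (b : I -> pred wcomp) nu :
  coef (\prod_i Fps (fun m => (b i m)%:R)) nu =
  #|[set d : {ffun I -> divisors_of nu} | [forall i, b i (val (d i))] &&
     (\big[mmul/mone]_i val (d i) == nu)]|%:R.
Proof.
rewrite -[X in coef X]mul1r coef_mul_prod_ind -sum1_card natr_sum.
rewrite big_mkcond [RHS]big_mkcond; apply: eq_bigr => d _; rewrite inE.
case: [forall i, _] => //=; set m := bigop.body _ _ _.
have -> : (m == nu) = wcomp_le m nu && (mone == divcm nu m) by rewrite -mmul_eq mulm1.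
by rewrite [mone == _]eq_sym; case: wcomp_le => //=; case: eqP.
Qed.

Local Notation hser m := (symf_val (symf_h m)).
Local Notation eser m := (symf_val (symf_e m)).

Lemma coef_hser m nu : coef (hser m) nu = (mdeg nu == m)%:R.
Proof. by []. Qed.

Lemma coef_eser m nu : coef (eser m) nu =
  ((mdeg nu == m) && all (fun i => nu i == 1%N) (enum_fset (finsupp nu)))%:R.
Proof. by []. Qed.

Lemma hser0 : hser 0 = 1.
Proof. by apply: fpsP => nu; rewrite Defs.coef1 coef_hser mdeg_eq0. Qed.

Lemma eser0 : eser 0 = 1.
Proof.
apply: fpsP => nu; rewrite Defs.coef1 coef_eser mdeg_eq0.
by case: eqP => //= ->; rewrite mdom1.
Qed.

(** * The relation between elementary and complete symmetric functions *)

Definition squarefree (m : wcomp) : bool := all (fun i => m i == 1%N) (enum_fset (finsupp m)).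

Lemma squarefreeP (m : wcomp) : reflect (forall i, m i <= 1)%N (squarefree m).
Proof.
apply: (iffP allP) => [h i|h i im].
  by case: (mdomP m i) => // im; rewrite (eqP (h _ im)).
by rewrite eqn_leq h lt0n cmE_neq0.
Qed.

(** This is the coefficient of [nu] in [E(-1) H(1) = 1]. For [nu] other than 1, the terms in which
    [a] contains a fixed variable [x_j] of [nu] cancel the others. *)
Lemma sum_sign_squarefree nu :
  \sum_(ab <- splits nu | squarefree ab.1) (-1) ^+ mdeg ab.1 = (nu == mone)%:R :> rat.
Proof.
have [->|nuN1] := eqVneq nu mone.
  have mem : (mone, mone) \in splits mone by rewrite mem_splits /= mul1m.
  rewrite big_mkcond (big_fsetD1 _ mem) /= {1}/squarefree mdom1 /= mdeg1 expr0.
  rewrite big1_fset ?addr0 // => -[a b].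
  rewrite in_fsetD1 mem_splits xpair_eqE /= => /andP[+ /eqP ab].
  have := wcomp_le_mull a b; have := wcomp_le_mulr a b.
  by rewrite ab !wcomp_le1 => /eqP-> /eqP->; rewrite !eqxx.
have [j nuj] : exists j, nu j != 0%N.
  case: (fset_0Vmem (finsupp nu)) => [nu0|[j]]; last by rewrite -cmE_neq0; exists j.
  by case/eqP: nuN1; apply: wcompP => i; apply/eqP; rewrite cm1 cmE_eq0 nu0.
rewrite (bigID (fun ab : wcomp * wcomp => ab.1 j == 0%N)) /= [X in _ + X](_ : _ =
  - \sum_(ab <- splits nu | squarefree ab.1 && (ab.1 j == 0%N)) (-1) ^+ mdeg ab.1).
  by rewrite subrr.
(* Moving one factor x_j from b to a is a sign-reversing bijection. *)
pose t (ab : wcomp * wcomp) := (mmul ab.1 (ucm j), divcm ab.2 (ucm j)).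
have U_eq (a : wcomp) i : mmul a (ucm j) i = (a i + (j == i))%N by rewrite cmM cmU.
rewrite -sumrN -[LHS]big_filter -[RHS]big_filter.
rewrite [LHS](perm_big [seq t ab | ab <- splits nu & squarefree ab.1 && (ab.1 j == 0%N)]).
  rewrite big_map; apply: eq_bigr => ab _ /=.
  by rewrite mdegM mdegU addn1 exprS mulN1r.
have bU a b : mmul a b = nu -> a j = 0%N -> wcomp_le (ucm j) b.
  move=> abE aj0; apply/wcomp_leP => i; rewrite cmU; case: eqP => //= <-.
  by move: nuj; rewrite lt0n -abE cmM aj0.
apply: uniq_perm; first by rewrite filter_uniq ?fset_uniq.
  rewrite map_inj_in_uniq ?filter_uniq ?fset_uniq // => -[a b] [c d].
  rewrite !mem_filter !mem_splits /= => /andP[/andP[_ /eqP aj] /eqP abE].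
  move=> /andP[/andP[_ /eqP cj] /eqP cdE] [ac bd].
  by rewrite -[a](divcm_mul (ucm j)) -[c](divcm_mul (ucm j)) mulmC ac mulmC;
    rewrite -(divcmK (bU _ _ abE aj)) -(divcmK (bU _ _ cdE cj)) bd.
move=> [a b]; rewrite mem_filter mem_splits /=; apply/andP/mapP.
  move=> [/andP[/squarefreeP asq aj] /eqP abE].
  have aj1 : a j = 1%N by apply/eqP; rewrite eqn_leq asq lt0n.
  have Ua : wcomp_le (ucm j) a.
    by apply/wcomp_leP => i; rewrite cmU; case: eqP => //= <-; rewrite aj1.
  exists (divcm a (ucm j), mmul (ucm j) b); last first.
    by rewrite /t /= divcm_mul mulmC divcmK.
  rewrite mem_filter mem_splits /= mulmA [mmul _ (ucm j)]mulmC divcmK // abE eqxx.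
  rewrite divcmE aj1 cmUU eqxx !andbT; apply/squarefreeP => i.
  by rewrite divcmE (leq_trans (leq_subr _ _)).
move=> [[c d]]; rewrite mem_filter mem_splits /=.
move=> /andP[/andP[/squarefreeP csq /eqP cj] /eqP cdE] [-> ->]; split.
  rewrite U_eq eqxx cj andbT; apply/squarefreeP => i; rewrite U_eq.
  by case: (eqVneq j i) => [<-|_]; rewrite ?cj ?addn0.
by rewrite -mulmA divcmK ?cdE // (bU _ _ cdE cj).
Qed.

(** For a fixed splitting [nu = a b] only [i = mdeg a] contributes, which leaves the signed sum over
    squarefree [a]. *)
Lemma sum_sign_eser_hser s :
  \sum_(i < s.+1) (-1) ^+ i *: (eser i * hser (s - i)) = (s == 0%N)%:R :> fps.
Proof.
apply: fpsP => nu; rewrite fps_coef_sum.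
transitivity ((mdeg nu == s)%:R *
    \sum_(ab <- splits nu | squarefree ab.1) (-1) ^+ mdeg ab.1 : rat).
  rewrite mulr_sumr; under eq_bigr do rewrite Defs.coefZ Defs.coefM mulr_sumr.
  rewrite exchange_big [RHS]big_mkcond /=; apply: eq_big_seq => -[a b] /=.
  rewrite mem_splits /= => /eqP <-; rewrite mdegM.
  have [as_|sa] := leqP (mdeg a) s; last first.
    rewrite big1 => [|i _]; last first.
      by rewrite /is_monom_e (gtn_eqF (leq_trans (ltn_ord i) sa)) mul0r mulr0.
    have /negPf -> : (mdeg a + mdeg b != s)%N by rewrite gtn_eqF // ltn_addr.
    by rewrite mul0r if_same.
  rewrite (bigD1 (Ordinal (as_ : (mdeg a < s.+1)%N))) //= big1 ?addr0 => [|i /eqP iN]; last first.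
    rewrite /is_monom_e; case: eqP => [e|_]; last by rewrite mul0r mulr0.
    by case: iN; apply: val_inj.
  rewrite /is_monom_e /is_monom_h eqxx /= -/(squarefree a) -(eqn_add2l (mdeg a) (mdeg b)).
  rewrite subnKC //; case: squarefree; last by rewrite mul0r mulr0.
  by rewrite mul1r mulrC.
rewrite sum_sign_squarefree; case: (eqVneq nu mone) => [->|nuN].
  by rewrite mdeg1 mulr1 eq_sym; case: eqP => _; rewrite ?mulr1n ?mulr0n ?Defs.coef1 ?eqxx.
by rewrite mulr0; case: eqP => _; rewrite ?mulr1n ?mulr0n ?Defs.coef1 ?(negPf nuN).
Qed.

(** * Weighted plane forests *)

Section ForestSeries.
Variable R : comNzRingType.
Implicit Types (z h : nat -> R).

(* Ordered forests with k trees and m nodes, a node with j children having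
   weight z j; the recursion removes the root of the first tree. *)
Fixpoint forest z (k m : nat) {struct m} : R :=
  match m, k with
  | 0, 0 => 1
  | m'.+1, k'.+1 => \sum_(j < m) z j * forest z (k' + j) m'
  | _, _ => 0
  end.

Lemma forest_small z k m : (m < k)%N -> forest z k m = 0.
Proof.
elim: m k => [|m IHm] [|k] //=; rewrite ltnS => mk.
by rewrite big1 // => j _; rewrite IHm ?mulr0 // (leq_trans mk) ?leq_addr.
Qed.

(** Terms with [k + j > m] vanish, so the range of [j] can be any [N] with [m < N + k]; this lets
    nested sums share one bound. *)
Lemma forestS z k m N : (m < N + k)%N ->
  forest z k.+1 m.+1 = \sum_(j < N) z j * forest z (k + j) m.
Proof.
move=> mN /=; rewrite -!(big_mkord xpredT (fun j => z j * forest z (k + j) m)).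
have tail a b : (m < a + k)%N -> \sum_(a <= j < b) z j * forest z (k + j) m = 0.
  move=> ma; rewrite big_nat big1 // => j /andP[aj _].
  by rewrite forest_small ?mulr0 // (leq_trans ma) // addnC leq_add2l.
case: (leqP N m.+1) => [le|/ltnW le]; last first.
  by rewrite [RHS](big_cat_nat _ le) //= [X in _ + X]tail ?addr0 ?ltn_addr.
by rewrite [LHS](big_cat_nat _ le) //= [X in _ + X]tail ?addr0.
Qed.

(* The coefficient of t^k in the l-th power of the sum of the h_c t^(c+1). *)
Fixpoint compositions h (l k : nat) : R :=
  if l is l'.+1 then \sum_(c < k) h c * compositions h l' (k.-1 - c) else (k == 0%N)%:R.

(** The hypothesis says [Z(-t) H(t) = 1] for the generating series of [z] and [h]. The series [F(u)]
    of plane trees solves [F = u Z(F)], so [F(-t H(t)) = -t]; the claim is the coefficient of [t^k]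
    in the [s]-th power of this equation. Terms with [l > k] vanish, so any bound [L >= k] will
    do. *)
Lemma forest_compositions z h :
    (forall s, \sum_(i < s.+1) (-1) ^+ i * (z i * h (s - i)%N) = (s == 0%N)%:R) ->
  forall s k L, (k <= L)%N ->
  \sum_(l < L.+1) (-1) ^+ l * (forest z s l * compositions h l k)
    = (-1) ^+ s * (k == s)%:R.
Proof.
move=> zh s k L; elim: L s k => [|L IHL] s k kL.
  by move: kL; rewrite leqn0 => /eqP ->; rewrite big_ord1; case: s => [|s] /=;
    rewrite ?mul0r ?mulr0 ?mulr1.
rewrite big_ord_recl; case: s => [|s]; rewrite [forest _ _ ord0]/=.
  rewrite big1 ?addr0 ?expr0 ?mul1r // => l _.
  by rewrite lift0 /= mul0r mulr0.
rewrite mul0r mulr0 add0r; case: k kL => [_|k]; last rewrite ltnS => kL.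
  by rewrite mulr0 big1 // => l _; rewrite lift0 /= big_ord0 !mulr0.
(* Remove the root of the first tree, with [j] children, and the first part [c + 1] of the
   composition. The inner sum then has the form of the induction hypothesis, for [s + j] and
   [k - c]. *)
have -> : \sum_(l < L.+1) (-1) ^+ (lift ord0 l) *
    (forest z s.+1 (lift ord0 l) * compositions h (lift ord0 l) k.+1) =
  - \sum_(j < L.+1) z j * \sum_(c < k.+1) h c *
    \sum_(l < L.+1) (-1) ^+ l * (forest z (s + j) l * compositions h l (k - c)).
  transitivity (- \sum_(l < L.+1) \sum_(j < L.+1) \sum_(c < k.+1)
      z j * (h c * ((-1) ^+ l * (forest z (s + j) l * compositions h l (k - c))))).
    rewrite -sumrN; apply: eq_bigr => l _; rewrite lift0 (@forestS _ _ _ L.+1); last first.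
      by rewrite (leq_trans (ltn_ord l)) // leq_addr.
    rewrite exprS mulN1r mulNr; congr (- _).
    rewrite mulr_suml mulr_sumr; apply: eq_bigr => j _.
    rewrite [compositions _ _ _]/= !mulr_sumr; apply: eq_bigr => c _.
    by rewrite /=; ring.
  congr (- _); rewrite exchange_big; apply: eq_bigr => j _.
  rewrite mulr_sumr exchange_big; apply: eq_bigr => c _.
  by rewrite !mulr_sumr.
rewrite eqSS exprS mulN1r mulNr; congr (- _).
(* The induction hypothesis leaves only [c = k - s - j]; what remains is the convolution [zh] at
   [k - s]. *)
transitivity ((-1) ^+ s * \sum_(j < L.+1 | (s + j <= k)%N)
   (-1) ^+ j * (z j * h (k - s - j)%N)).
  rewrite mulr_sumr [RHS]big_mkcond; apply: eq_bigr => j _.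
  transitivity (z j * \sum_(c < k.+1) h c * ((-1) ^+ (s + j) * (k - c == s + j)%N%:R)).
    by congr (_ * _); apply: eq_bigr => c _; rewrite IHL // (leq_trans (leq_subr _ _)).
  case: ifP => sjk; last first.
    rewrite big1 ?mulr0 // => c _; case: eqP => [e|_]; last by rewrite !mulr0.
    by rewrite -e leq_subr in sjk.
  have lt : (k - (s + j) < k.+1)%N by rewrite ltnS leq_subr.
  rewrite (bigD1 (Ordinal lt)) //= subKn // eqxx mulr1 big1 ?addr0 => [|c /eqP cN].
    by rewrite exprD subnDA; ring.
  case: eqP => [e|_]; last by rewrite !mulr0.
  by case: cN; apply: val_inj; rewrite /= -e subKn // -ltnS.
congr (_ * _); case: (leqP s k) => [sk|ks]; last first.
  rewrite big1 ?ltn_eqF // => j /(leq_trans (leq_addr _ _)).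
  by rewrite leqNgt ks.
have -> : (k == s) = (k - s == 0)%N by rewrite subn_eq0 eqn_leq sk andbT.
rewrite -zh (big_ord_widen L.+1 (fun i => (-1) ^+ i * (z i * h (k - s - i)%N))).
  by apply: eq_bigl => j; rewrite ltnS leq_subRL.
by rewrite ltnS (leq_trans (leq_subr _ _)).
Qed.

Lemma big_ffun_ord_recl (T : finType) m (P : pred {ffun 'I_m.+1 -> T}) F
    (cons := fun x (b : {ffun 'I_m -> T}) => [ffun i => oapp b x (unlift ord0 i)]) :
  \sum_(a | P a) F a = \sum_x \sum_(b | P (cons x b)) F (cons x b) :> R.
Proof.
rewrite pair_big_dep /=.
pose g (p : T * {ffun 'I_m -> T}) := cons p.1 p.2.
pose g' (a : {ffun 'I_m.+1 -> T}) := (a ord0, [ffun i => a (lift ord0 i)]).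
rewrite (reindex g) //; exists g' => [[x b] _|a _]; rewrite /g /g' /cons /=.
  rewrite ffunE unlift_none; congr pair; apply/ffunP => i.
  by rewrite !ffunE liftK.
by apply/ffunP => i; rewrite !ffunE; case: unliftP => [j|] -> //=; rewrite ffunE.
Qed.

(** Reading a node with [a i] children replaces one pending tree by [a i] trees. Starting from [k]
    trees, at least one must stay pending after each letter, and exactly one is pending at the end:
    the last leaf, whose letter 0 is omitted. So words of length [m] encode forests with [m + 1]
    nodes. *)
Definition ballot N m (k : nat) (a : {ffun 'I_m -> 'I_N}) : bool :=
  [forall i : 'I_m, i.+1 < k + \sum_(j : 'I_m | (j <= i)%N) a j]%N
  && (k + \sum_(i : 'I_m) a i == m.+1)%N.

(* Lukasiewicz words: reading the numbers of children in depth-first order. *)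
Lemma sum_ballot z N m k : z 0%N = 1 -> (0 < k)%N -> (m < N)%N ->
  \sum_(a : {ffun 'I_m -> 'I_N} | ballot k a) \prod_i z (a i) = forest z k m.+1.
Proof.
move=> z0; elim: m k => [|m IHm] [|k] // _ mN.
  (* The only node is the leaf that the word omits, with weight [z 0 = 1]. *)
  rewrite (@forestS _ _ _ 1) // big_ord1 z0 mul1r addn0.
  have ball (a : {ffun 'I_0 -> 'I_N}) : ballot k.+1 a = (k == 0%N).
    rewrite /ballot big_ord0 addn0 eqSS; case: forallP => // -[] [] //.
  under eq_bigl do rewrite ball; under eq_bigr do rewrite big_ord0.
  case: k {ball} => [|k]; last by rewrite big_pred0.
  by rewrite sumr_const card_ffun !card_ord expn0.
rewrite (@forestS _ _ _ N) ?ltn_addr // big_ffun_ord_recl; apply: eq_bigr => x _.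
set cons := fun b : {ffun 'I_m -> 'I_N} => [ffun i => oapp b x (unlift ord0 i)] : {ffun _ -> _}.
have cons0 b : cons b ord0 = x by rewrite ffunE unlift_none.
have consS b i : cons b (lift ord0 i) = b i by rewrite ffunE liftK.
(* After the first letter [x] there are [k + x] pending trees, and this number must be positive. *)
have ballE b : ballot k.+1 (cons b) = (0 < k + x)%N && ballot (k + x) b.
  rewrite /ballot; have -> : (k.+1 + \sum_(i < m.+1) cons b i == m.+2)%N =
      (k + x + \sum_(i < m) b i == m.+1)%N.
    rewrite big_ord_recl cons0 addnA !addSn eqSS.
    by under eq_bigr do rewrite consS.
  rewrite andbA; congr (_ && _).
  have sumE (i : 'I_m) : (\sum_(j < m.+1 | (j <= lift ord0 i)%N) cons b j =
      x + \sum_(j < m | (j <= i)%N) b j)%N.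
    rewrite big_mkcond big_ord_recl /= cons0; congr (_ + _)%N.
    rewrite [RHS]big_mkcond; apply: eq_bigr => j _.
    by rewrite consS /bump !add1n ltnS.
  apply/forallP/andP => [h|[kx /forallP h] i].
    split.
      have := h ord0; rewrite big_mkcond big_ord_recl /= cons0 big1 ?addn0 ?addSn //.
    apply/forallP => i; have := h (lift ord0 i).
    by rewrite sumE lift0 addSn ltnS addnA.
  case: (unliftP ord0 i) => [j|] ->.
    by rewrite sumE lift0 addSn ltnS addnA.
  by rewrite big_mkcond big_ord_recl /= cons0 big1 ?addn0 ?addSn.
under eq_bigl do rewrite ballE.
under eq_bigr => b _ do [rewrite big_ord_recl cons0; under eq_bigr do rewrite consS].
case: posnP => kx /=; last by rewrite -mulr_sumr IHm // ltnW.
by rewrite big_pred0 // kx mulr0.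
Qed.

End ForestSeries.

(** * Moebius functions and interval partitions *)

Lemma mobius_sum d (T : porderType d)
    (finT : forall x y : T, finite_set [set z : T | (x <= z <= y)%O]%classic)
    (x y : T) : (x <= y)%O -> \sum_(z <- itv_fset x y) mobius x z = (x == y)%:R.
Proof.
rewrite le_eqVlt => /predU1P[->|xy]; last by rewrite mobius_sum0 // lt_eqF.
have yI : y \in itv_fset y y by rewrite mem_itv_fset // lexx.
rewrite (big_fsetD1 y yI) /= mobiusE // eqxx big1_fset ?addr0 // => z.
by rewrite in_fsetD1 mem_itv_fset // => /andP[/negP zN] /le_anti e; case: zN; rewrite e.
Qed.

(* Moebius inversion from above: the inverse of the zeta function is two-sided. *)
Lemma mobius_dual d (T : porderType d)
    (finT : forall x y : T, finite_set [set z : T | (x <= z <= y)%O]%classic)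
    (v : T -> rat) (top : T) :
    (forall x, (x <= top)%O -> \sum_(z <- itv_fset x top) v z = (x == top)%:R) ->
  forall x, (x <= top)%O -> (mobius x top)%:~R = v x.
Proof.
move=> vsum x xtop.
have itvl z : z \in itv_fset x top -> forall F : T -> rat,
    \sum_(w <- itv_fset z top) F w = \sum_(w <- itv_fset x top | (z <= w)%O) F w.
  rewrite mem_itv_fset // => /andP[xz ztop] F; rewrite -[RHS]big_filter.
  apply: perm_big; apply: uniq_perm; rewrite ?filter_uniq ?fset_uniq // => w.
  rewrite mem_filter !mem_itv_fset //; case: (boolP (z <= w)%O) => //= zw.
  by rewrite (le_trans xz zw).
have itvr z : z \in itv_fset x top -> forall F : T -> rat,
    \sum_(w <- itv_fset x z) F w = \sum_(w <- itv_fset x top | (w <= z)%O) F w.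
  rewrite mem_itv_fset // => /andP[xz ztop] F; rewrite -[RHS]big_filter.
  apply: perm_big; apply: uniq_perm; rewrite ?filter_uniq ?fset_uniq // => w.
  rewrite mem_filter !mem_itv_fset // andbC; case: (boolP (w <= z)%O) => //= wz.
  by rewrite (le_trans wz ztop) andbT.
have topI : top \in itv_fset x top by rewrite mem_itv_fset // xtop lexx.
have xI : x \in itv_fset x top by rewrite mem_itv_fset // xtop lexx.
(* Sum [mu(x, z) v(w)] over [x <= z <= w <= top] in two ways: summing over [w] first leaves
   [z = top], summing over [z] first leaves [w = x]. *)
transitivity (\sum_(z <- itv_fset x top) \sum_(w <- itv_fset x top | (z <= w)%O)
    (mobius x z)%:~R * v w).
  rewrite (big_fsetD1 top topI) /= -itvl // -mulr_sumr vsum // eqxx mulr1.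
  rewrite big1_fset ?addr0 // => z; rewrite in_fsetD1 => /andP[zN zI] _.
  rewrite -itvl // -mulr_sumr vsum ?(negPf zN) ?mulr0 //.
  by move: zI; rewrite mem_itv_fset // => /andP[].
rewrite (exchange_big_dep predT) //= (big_fsetD1 x xI) /=.
rewrite -itvr // -mulr_suml -rmorph_sum /= mobius_sum // eqxx mul1r.
rewrite big1_fset ?addr0 // => w; rewrite in_fsetD1 => /andP[wN wI] _.
have xw : (x <= w)%O by move: wI; rewrite mem_itv_fset // => /andP[].
by rewrite -itvr // -mulr_suml -rmorph_sum /= mobius_sum // eq_sym (negPf wN) mul0r.
Qed.

(** * Interval partitions with prescribed starting points *)

Section IntervalPartitions.
Variable n : nat.
Implicit Types (S B : {set 'I_n}) (Y : {set {set 'I_n}}) (a b : nat).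

Definition tail a : {set 'I_n} := [set i : 'I_n | (a <= i)%N].
Definition segment a b : {set 'I_n} := [set i : 'I_n | (a <= i < b)%N].

Definition convex B : bool :=
  [forall i in B, forall k in B, forall j : 'I_n, (i <= j <= k)%N ==> (j \in B)].

Lemma convexP B : reflect (forall i j k : 'I_n, i \in B -> k \in B ->
  (i <= j)%N -> (j <= k)%N -> j \in B) (convex B).
Proof.
apply: (iffP forall_inP) => [h i j k iB kB ij jk|h i iB].
  by have /forall_inP/(_ k kB)/forallP/(_ j) := h i iB; rewrite ij jk.
by apply/forall_inP => k kB; apply/forallP => j; apply/implyP => /andP[]; apply: h.
Qed.

(* Partitions of the tail [a, n) into intervals that start in S. *)
Definition interval_parts S a : {set {set {set 'I_n}}} :=
  [set Y | [&& partition Y (tail a), [forall B in Y, convex B]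
    & [forall B in Y, forall i in B, (B \subset tail i) ==> (i \in S)]]].

Lemma interval_partsP S a Y : reflect
  [/\ partition Y (tail a), {in Y, forall B, convex B}
    & forall B i, B \in Y -> i \in B -> B \subset tail i -> i \in S]
  (Y \in interval_parts S a).
Proof.
rewrite inE; apply: (iffP and3P) => [[pY /forall_inP cY /forall_inP sY]|[pY cY sY]].
  by split=> // B i BY iB; have /forall_inP/(_ i iB)/implyP := sY B BY.
split=> //; first exact/forall_inP.
by apply/forall_inP => B BY; apply/forall_inP => i iB; apply/implyP; apply: sY.
Qed.

(** For [b = n] no index has value [b], so the right end always counts as a boundary. *)
Definition boundary S b : bool := [forall i : 'I_n, (i == b :> nat) ==> (i \in S)].

Lemma boundaryP S b : reflect (forall i : 'I_n, i = b :> nat -> i \in S) (boundary S b).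
Proof.
apply: (iffP forallP) => [h i /eqP ib|h i]; first exact: (implyP (h i)).
by apply/implyP => /eqP; apply: h.
Qed.

Lemma segment_inj a b b' : (a < b)%N -> (b <= n)%N -> (a < b')%N -> (b' <= n)%N ->
  segment a b = segment a b' -> b = b'.
Proof.
move=> ab bn ab' bn' e; wlog lt_b : b b' ab bn ab' bn' e / (b < b')%N.
  by case: (ltngtP b b') => // bb' w; [|symmetry]; apply: w.
move/setP: e => /(_ (Ordinal (leq_trans lt_b bn'))).
by rewrite !inE /= ltnn andbF lt_b (ltnW ab).
Qed.

(** The block of [a] is convex, so it runs from [a] to its largest element [m]; the next block, if
    [m.+1 < n], starts at [m.+1]. *)
Lemma interval_parts_first S a Y : (a < n)%N -> Y \in interval_parts S a ->
  exists b : 'I_n.+1, [/\ (a < b)%N, segment a b \in Y & boundary S b].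
Proof.
move=> an /interval_partsP[pY cY sY]; have [/eqP covY tY _] := and3P pY.
pose i0 := Ordinal an; have i0Y : i0 \in cover Y by rewrite covY inE.
set B := pblock Y i0; have BY : B \in Y by apply: pblock_mem.
have i0B : i0 \in B by rewrite mem_pblock.
have Ba i : i \in B -> (a <= i)%N.
  by move/(subsetP (partitionS pY BY)); rewrite inE.
case: (@arg_maxnP _ i0 (mem B) (fun i => i : nat) i0B) => m mB mmax.
have segB : segment a m.+1 = B.
  apply/setP => i; rewrite inE ltnS; apply/andP/idP => [[ai im]|iB].
    by move/convexP: (cY B BY) => /(_ i0 i m); apply.
  by split; [exact: Ba|exact: mmax].
have mn : (m.+1 < n.+1)%N by rewrite ltnS.
exists (Ordinal mn); split=> /=; [by rewrite ltnS Ba|by rewrite segB|].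
apply/boundaryP => i im.
have iY : i \in cover Y by rewrite covY inE im ltnW // ltnS Ba.
have iB' : i \in pblock Y i by rewrite mem_pblock.
have B'Y := pblock_mem iY.
(* The least element of the block of [i] is [i] itself: a smaller element [j] would lie in [B], and
   then [i] would as well. *)
apply: (sY _ i B'Y iB'); apply/subsetP => j jB'; rewrite inE leqNgt.
apply/negP => ji; have jB : j \in B.
  rewrite -segB inE -im ji andbT.
  by have := subsetP (partitionS pY B'Y) _ jB'; rewrite inE.
have e : pblock Y i = B by rewrite -(def_pblock tY B'Y jB') (def_pblock tY BY jB).
by move: iB'; rewrite e -segB inE im ltnn andbF.
Qed.

Lemma tailD_segment a b : (a <= b)%N -> tail a :\: segment a b = tail b.
Proof.
move=> ab; apply/setP => i; rewrite !inE.
by case: (leqP b i) => [bi|_]; [rewrite andbF (leq_trans ab bi)|rewrite andbT andNb].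
Qed.

Lemma interval_partsD1 S a b Y : (a < b)%N -> Y \in interval_parts S a ->
  segment a b \in Y -> Y :\ segment a b \in interval_parts S b.
Proof.
move=> ab /interval_partsP[pY cY sY] BY; apply/interval_partsP; split.
- have := partitionD1 pY BY; by rewrite tailD_segment // ltnW.
- by move=> B /setD1P[_]; apply: cY.
- by move=> B i /setD1P[_]; apply: sY.
Qed.

Lemma segment_notin S a b Y : (a < n)%N -> (a < b)%N -> Y \in interval_parts S b ->
  segment a b \notin Y.
Proof.
move=> an ab /interval_partsP[pY _ _]; apply/negP => BY.
have : Ordinal an \in segment a b by rewrite inE /= leqnn ab.
by move/(subsetP (partitionS pY BY)); rewrite inE /= leqNgt ab.
Qed.

Lemma interval_partsU1 S a b Y : (a < n)%N -> (a < b)%N -> boundary S a ->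
  Y \in interval_parts S b -> segment a b |: Y \in interval_parts S a.
Proof.
move=> an ab /boundaryP Sa YS; have [pY cY sY] := interval_partsP _ _ _ YS.
apply/interval_partsP; split.
- have -> : tail a = segment a b :|: tail b.
    apply/setP => i; rewrite !inE; case: (leqP b i) => [bi|_]; last by rewrite andbT orbF.
    by rewrite andbF (leq_trans (ltnW ab) bi).
  apply: partitionU1 => //.
    by apply/set0Pn; exists (Ordinal an); rewrite inE /= leqnn ab.
  rewrite -setI_eq0; apply/eqP/setP => i; rewrite !inE ltnNge.
  by case: (b <= i)%N; rewrite ?andbF.
- move=> B /setU1P[->|]; last exact: cY.
  apply/convexP => i j k; rewrite !inE => /andP[ai _] /andP[_ kb] ij jk.
  by rewrite (leq_trans ai ij) (leq_ltn_trans jk kb).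
- move=> B i /setU1P[->|]; last exact: sY.
  rewrite inE => /andP[ai _] /subsetP/(_ (Ordinal an)); rewrite !inE /= leqnn ab.
  by move=> /(_ isT) ia; apply: Sa; apply/eqP; rewrite eqn_leq ia ai.
Qed.

Lemma interval_parts_end S : interval_parts S n = [set set0].
Proof.
have tn : tail n = set0 by apply/setP => i; rewrite !inE leqNgt ltn_ord.
apply/setP => Y; rewrite [in RHS]inE; apply/interval_partsP/eqP => [[]|->].
  by rewrite tn partition_set0 => /eqP.
by split; [rewrite tn partition_set0| move=> B; rewrite inE| move=> B i; rewrite inE].
Qed.

(** * Summation over interval partitions by ranks of boundaries *)

Definition rank_from S a := #|S :&: tail a|.

Lemma rank_fromS S a : (a < n)%N -> rank_from S a = (boundary S a + rank_from S a.+1)%N.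
Proof.
move=> an; pose i := Ordinal an.
have -> : boundary S a = (i \in S).
  apply/boundaryP/idP => [|iS j ja]; first exact.
  by rewrite (_ : j = i) //; apply: val_inj.
rewrite /rank_from (cardsD1 i) !inE leqnn andbT; congr (_ + _)%N.
apply: eq_card => j; rewrite !inE -val_eqE /= andbCA; congr (_ && _).
by rewrite [RHS]ltn_neqAle eq_sym.
Qed.

Lemma rank_from_end S a : (n <= a)%N -> rank_from S a = 0%N.
Proof.
move=> na; apply/eqP; rewrite cards_eq0; apply/eqP/setP => i; rewrite !inE.
by rewrite leqNgt (leq_trans (ltn_ord i) na) andbF.
Qed.

(** Along the boundaries from [a] to [n] the rank drops by one each time and is 0 at [n], so every
    [c] occurs exactly once. *)
Lemma sum_boundary (V : nmodType) S (g : nat -> V) a : (a <= n)%N ->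
  \sum_(b < n.+1 | (a <= b)%N && boundary S b) g (rank_from S b) =
  \sum_(c < (rank_from S a).+1) g c.
Proof.
move=> an; rewrite -(subKn an); move: (n - a)%N (leq_subr a n) => {an} k.
elim: k => [_|k IHk kn].
  rewrite subn0 rank_from_end // big_ord1 (big_pred1 ord_max) ?rank_from_end //.
  move=> b /=; apply/andP/eqP => [[nb _]|->].
    by apply/val_inj/eqP; rewrite /= eqn_leq nb -ltnS ltn_ord.
  by split=> //=; apply/boundaryP => i e; have := ltn_ord i; rewrite e ltnn.
have := IHk (ltnW kn); set a' := (n - k)%N => {}IHk.
have a'E : a' = (n - k.+1).+1 by rewrite /a' subnS prednK // subn_gt0.
move: a'E; set a'' := (n - k.+1)%N => a'E.
have a''n : (a'' < n)%N by rewrite -a'E leq_subr.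
have [Sa|Sa] := boolP (boundary S a''); last first.
  rewrite rank_fromS // (negPf Sa) -a'E -IHk; apply: eq_bigl => b.
  rewrite a'E [in RHS]ltn_neqAle; case: (eqVneq a'' b) => [<-|] //=.
  by rewrite (negPf Sa) andbF.
rewrite rank_fromS // Sa -a'E add1n big_ord_recr /= -IHk.
have lt : (a'' < n.+1)%N by rewrite ltnS ltnW.
rewrite (bigD1 (Ordinal lt)) /= ?leqnn // addrC rank_fromS // Sa -a'E add1n.
congr (_ + _); apply: eq_bigl => b; rewrite a'E ltn_neqAle -val_eqE /=.
by rewrite [in RHS]eq_sym; case: (a'' <= b)%N; case: boundary; rewrite ?andbT ?andbF.
Qed.

(** Every block starts in [S], so the blocks cut [S] into consecutive nonempty runs, and the run
    sizes form an arbitrary composition of [rank_from S a]. The induction removes the first block;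
    as this shifts the argument of [f], the function [f] is kept general. *)
Lemma sum_interval_parts (R : comNzRingType) (h : nat -> R) S (f : nat -> R) a L :
    (a <= n)%N -> boundary S a -> (rank_from S a <= L)%N ->
  \sum_(Y in interval_parts S a) f #|Y| * \prod_(B in Y) h #|S :&: B|.-1 =
  \sum_(l < L.+1) f l * compositions h l (rank_from S a).
Proof.
have [k] := ubnP (n - a); elim: k => // k IHk in a f L *.
rewrite ltnS => nak; rewrite leq_eqVlt => /predU1P[->|an] Sa raL.
  rewrite interval_parts_end big_set1 cards0 big_set0 mulr1 rank_from_end //.
  rewrite big_ord_recl /= mulr1 big1 ?addr0 // => l _.
  by rewrite /= big_ord0 mulr0.
have ra : rank_from S a = (rank_from S a.+1).+1 by rewrite rank_fromS // Sa.
(* The right end of the block that starts at [a]. The default [ord0] is never taken on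
   [interval_parts S a]. *)
pose p Y : 'I_n.+1 := odflt ord0 [pick b : 'I_n.+1 | (a < b)%N && (segment a b \in Y)].
have pE Y (b : 'I_n.+1) : Y \in interval_parts S a -> (a < b)%N -> segment a b \in Y -> p Y = b.
  move=> /interval_partsP[/and3P[_ tY _] _ _] ab bY; rewrite /p.
  case: pickP => [b' /andP[ab' b'Y]|/(_ b)] /=; last by rewrite ab bY.
  have inseg c : (a < c)%N -> Ordinal an \in segment a c by rewrite inE /= leqnn.
  apply/val_inj; apply: (segment_inj ab' _ ab); rewrite -1?ltnS //.
  by rewrite -(def_pblock tY b'Y (inseg _ ab')) -(def_pblock tY bY (inseg _ ab)).
rewrite (partition_big p (fun b : 'I_n.+1 => (a.+1 <= b)%N && boundary S b)) /=; last first.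
  by move=> Y YS; have [b [ab bY Sb]] := interval_parts_first an YS; rewrite (pE Y b) // ab.
case: L raL => [|L] raL; first by rewrite ra in raL.
pose g c := h (rank_from S a.+1 - c)%N * \sum_(l < L.+1) f l.+1 * compositions h l c.
transitivity (\sum_(b < n.+1 | (a.+1 <= b)%N && boundary S b) g (rank_from S b)).
  apply: eq_bigr => b /andP[ab Sb].
  rewrite (reindex_onto (fun Y => segment a b |: Y) (fun Y => Y :\ segment a b)) /=; last first.
    move=> Y /andP[YS /eqP pY]; apply: setD1K.
    by have [b' [ab' b'Y _]] := interval_parts_first an YS; rewrite -pY (pE Y b').
  rewrite (eq_bigl (mem (interval_parts S b))) /=; last first.
    move=> Y; apply/andP/idP => [[/andP[YS _] /eqP <-]|YS].
      by apply: interval_partsD1 => //; rewrite setU11.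
    have US := interval_partsU1 an ab Sa YS.
    by rewrite US (pE _ b) ?setU11 // setU1K ?eqxx ?(segment_notin an ab YS).
  have rab : (rank_from S a = #|S :&: segment a b| + rank_from S b)%N.
    rewrite /rank_from -(cardsID (segment a b) (S :&: tail a)) -setIDA.
    rewrite tailD_segment ?(ltnW ab) //; congr (_ + _)%N; rewrite -setIA.
    congr #|pred_of_set (_ :&: _)|; apply/setIidPr/subsetP => i.
    by rewrite !inE => /andP[].
  rewrite /g; have -> : \sum_(l < L.+1) f l.+1 * compositions h l (rank_from S b) =
      \sum_(Y in interval_parts S b) f #|Y|.+1 * \prod_(B in Y) h #|S :&: B|.-1.
    rewrite (IHk b (fun l => f l.+1) L) //.
    - by rewrite (leq_trans _ nak) // ltn_sub2l.
    - by rewrite -ltnS.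
    - move: raL; rewrite ra ltnS; apply: leq_trans; apply: subset_leq_card; apply: setIS.
      by apply/subsetP => i; rewrite !inE; apply: leq_trans.
  rewrite mulr_sumr; apply: eq_bigr => Y YS.
  have bY := segment_notin an ab YS.
  rewrite cardsU1 bY add1n big_setU1 //= mulrCA; congr (_ * _); congr (h _).
  have := rab; rewrite ra => /(congr1 predn) /= ->.
  case: #|S :&: segment a b| (rab) => [|c]; last by rewrite addSn /= addnK.
  rewrite add0n ra => e; exfalso.
  have : (rank_from S b <= rank_from S a.+1)%N.
    by apply: subset_leq_card; apply: setIS; apply/subsetP => i; rewrite !inE; apply: leq_trans.
  by rewrite -e ltnn.
(* The end [b] enters only through its rank. Reversing the order of the ranks makes the summation
   index the first part of the composition; the term [l = 0] vanishes because the rank of [a] is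
   positive. *)
rewrite sum_boundary // ra /g.
rewrite [RHS]big_ord_recl /= mulr0 add0r (reindex_inj rev_ord_inj) /=.
under eq_bigr => c _ do rewrite subSS subKn -1?ltnS // mulr_sumr.
rewrite exchange_big; apply: eq_bigr => l _ /=; rewrite mulr_sumr.
by apply: eq_bigr => c _; rewrite mulrCA.
Qed.

End IntervalPartitions.

(** * Upper intervals of weighted partitions *)

Lemma wcomp_leM (a b c : wcomp) :
  wcomp_le (mmul a b) c = wcomp_le a c && wcomp_le b (divcm c a).
Proof.
apply/wcomp_leP/andP => [h|[/wcomp_leP ac /wcomp_leP bc] i].
  split; apply/wcomp_leP => i; have := h i; rewrite cmM.
    by apply: leq_trans; apply: leq_addr.
  by move=> abc; rewrite divcmE leq_subRL // (leq_trans _ abc) ?leq_addr.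
by have := bc i; rewrite divcmE leq_subRL // cmM.
Qed.

Lemma wcomp_le_bigmul (I : finType) (F : I -> wcomp) i :
  wcomp_le (F i) (\big[mmul/mone]_j F j).
Proof. by rewrite (bigD1 i) //=; exact: wcomp_le_mull. Qed.

Section WeightedPartitions.
Variable T : finType.
Implicit Types (x y : wpart T) (Y Q : {set {set T}}) (A B : {set T}).

Definition total_weight x : wcomp := \big[mmul/mone]_(B in blocks x) weight x B.

Definition below x B : wcomp :=
  \big[mmul/mone]_(A in blocks x | A \subset B) weight x A.

Definition nblocks x B : nat := #|[set A in blocks x | A \subset B]|.

Definition refines Q Y : bool := [forall A in Q, [exists B in Y, A \subset B]].

Lemma wpart_leE x y : wpart_le x y = refines (blocks x) (blocks y) &&
  [forall B in blocks y, wcomp_le (below x B) (weight y B)].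
Proof. by []. Qed.

Lemma wpart_mdeg x B : B \in blocks x -> mdeg (weight x B) = #|B|.-1.
Proof. by case/and3P: (valP x) => _ /forall_inP h _ /h/eqP. Qed.

Lemma mdeg_weights x Q : Q \subset blocks x ->
  (mdeg (\big[mmul/mone]_(B in Q) weight x B) + #|Q| = \sum_(B in Q) #|B|)%N.
Proof.
move=> /subsetP Qx; rewrite mdeg_prod -sum1_card -big_split /=.
apply: eq_bigr => B /Qx BQ; rewrite wpart_mdeg // addn1 prednK //.
by rewrite card_gt0 (wpart_block_neq0 BQ).
Qed.

Lemma mdeg_total x : (mdeg (total_weight x) + #|blocks x| = #|T|)%N.
Proof. by rewrite mdeg_weights // -(card_partition (wpart_partition x)) cardsT. Qed.

Lemma pblock_block x i : (pblock (blocks x) i \in blocks x) * (i \in pblock (blocks x) i).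
Proof.
have ic : i \in cover (blocks x) by rewrite (cover_partition (wpart_partition x)) inE.
by rewrite pblock_mem // mem_pblock.
Qed.

Section Coarser.
Variables (x : wpart T) (Y : {set {set T}}).
Hypotheses (pY : partition Y [set: T]) (rY : refines (blocks x) Y).

Lemma coarse_block i B : B \in Y -> i \in B -> pblock (blocks x) i \subset B.
Proof.
move=> BY iB; have [Ax iA] := pblock_block x i.
have /exists_inP[C CY AC] := forall_inP rY _ Ax.
have tY := partition_trivIset pY.
by rewrite -(def_pblock tY BY iB) (def_pblock tY CY (subsetP AC _ iA)).
Qed.

Lemma below_total : \big[mmul/mone]_(B in Y) below x B = total_weight x.
Proof.
rewrite /below (exchange_big_dep (mem (blocks x))) /= => [|B A _ /andP[]//].
apply: eq_bigr => A Ax; rewrite (eq_bigl [pred B | (B \in Y) && (A \subset B)]); last first.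
  by move=> B; rewrite /= Ax.
have [i iA] := set0Pn _ (wpart_block_neq0 Ax).
have /exists_inP[C CY AC] := forall_inP rY _ Ax.
rewrite (big_pred1 C) // => B /=; apply/andP/eqP => [[BY AB]|-> //].
have tY := partition_trivIset pY.
by rewrite -(def_pblock tY BY (subsetP AB _ iA)) (def_pblock tY CY (subsetP AC _ iA)).
Qed.

(** Each block of [x] inside [B] loses one degree. As the weight of [B] must have degree [#|B| - 1],
    it exceeds [below x B] by a composition of degree [nblocks x B - 1]. *)
Lemma mdeg_below B : B \in Y -> (mdeg (below x B) + nblocks x B = #|B|)%N.
Proof.
move=> BY; set Q := [set A in blocks x | A \subset B].
have QE : below x B = \big[mmul/mone]_(A in Q) weight x A.
  by apply: eq_bigl => A; rewrite inE.
rewrite QE mdeg_weights; last by apply/subsetP => A; rewrite inE => /andP[].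
rewrite -(@card_partition _ Q B) //; apply/and3P; split.
- apply/eqP/setP => i; apply/bigcupP/idP => [[A]|iB].
    by rewrite inE => /andP[_ /subsetP AB] /AB.
  have [Ax iA] := pblock_block x i.
  by exists (pblock (blocks x) i) => //; rewrite inE Ax coarse_block.
- apply: trivIsetS (partition_trivIset (wpart_partition x)).
  by apply/subsetP => A; rewrite inE => /andP[].
- by rewrite inE negb_and (partition0 (wpart_partition x)).
Qed.

Lemma nblocks_gt0 B : B \in Y -> (0 < nblocks x B)%N.
Proof.
move=> BY; have [i iB] := set0Pn _ (partition_neq0 pY BY).
rewrite card_gt0; apply/set0Pn; exists (pblock (blocks x) i).
by rewrite inE (pblock_block x i) coarse_block.
Qed.

Lemma total_below y (g : {set T} -> wcomp) : blocks y = Y ->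
  (forall B, B \in Y -> weight y B = mmul (below x B) (g B)) ->
  (forall B, B \notin Y -> g B = mone) ->
  total_weight y = mmul (total_weight x) (\big[mmul/mone]_B g B).
Proof.
move=> yY wE g1; rewrite /total_weight yY (eq_bigr _ wE) big_split /= below_total.
congr mmul; rewrite big_mkcond; apply: eq_bigr => B _.
by case: ifPn => // /g1.
Qed.
End Coarser.
End WeightedPartitions.

(** * Elements of an upper interval with given blocks *)

Section UpperInterval.
Variable G : sgraph.
Variables x top : gpart G.
Hypothesis top_blocks : blocks top = [set [set: G]].

Lemma le_top (y : gpart G) : (y <= top)%O = wcomp_le (total_weight y) (weight top [set: G]).
Proof.
rewrite -[LHS]/(wpart_le y top) wpart_leE top_blocks.
have -> : refines (blocks y) [set [set: G]].
  by apply/forall_inP => A _; apply/exists_inP; exists [set: G]; rewrite ?inE ?subsetT.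
have totE : total_weight y = below y [set: G].
  by apply: eq_bigl => A; rewrite subsetT andbT.
by rewrite totE; apply/forall_inP/idP => [|h B /set1P ->//]; apply; rewrite inE.
Qed.

Hypothesis le_x_top : (x <= top)%O.

(** Such a [y] amounts to an extra weight of degree [nblocks x B - 1] on each [B] in [Y], subject
    only to their product dividing [rho]. These choices are the monomials in the expansion of the
    product of complete symmetric functions. *)
Lemma sum_upper_interval (f : fps) (Y : {set {set G}}) :
    partition Y [set: G] -> refines (blocks x) Y ->
    {in Y, forall B, connected_in B} ->
  \sum_(y <- itv_fset x top | blocks y == Y)
     coef f (divcm (weight top [set: G]) (total_weight y)) =
  coef (f * \prod_(B in Y) hser (nblocks x B).-1)
       (divcm (weight top [set: G]) (total_weight x)).
Proof.
move=> pY rY cY; set nu := weight top _; set rho := divcm nu (total_weight x).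
have xnu : wcomp_le (total_weight x) nu by rewrite -le_top.
have D1 : mone \in divisors_of rho.
  by rewrite mem_divisors_of; apply/wcomp_leP => i; rewrite cm1.
pose q (y : gpart G) B := divcm (weight y B) (below x B).
pose psi (y : gpart G) : {ffun {set G} -> divisors_of rho} :=
  [ffun B => insubd [` D1]%fset (q y B)].
(* Degree 0 outside [Y] extends the product to all sets by factors [h_0 = 1]. *)
pose deg B := if B \in Y then (nblocks x B).-1 else 0%N.
have qP (y : gpart G) : y \in itv_fset x top -> blocks y = Y ->
  [/\ forall B, B \in Y -> weight y B = mmul (below x B) (q y B),
      forall B, B \notin Y -> q y B = mone,
      total_weight y = mmul (total_weight x) (\big[mmul/mone]_B q y B),
      wcomp_le (\big[mmul/mone]_B q y B) rho & forall B, val (psi y B) = q y B].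
  rewrite (mem_itv_fset (@finite_gpart_itv G)) => /andP[xy].
  rewrite le_top -/nu => ytop yY.
  have wE B : B \in Y -> weight y B = mmul (below x B) (q y B).
    move: xy; rewrite -[(x <= y)%O]/(wpart_le x y) wpart_leE yY => /andP[_ /forall_inP h].
    by move=> /h ?; rewrite /q divcmK.
  have q1 B : B \notin Y -> q y B = mone.
    rewrite -yY => BY; apply: wcompP => i.
    by rewrite divcmE wpart_weight0 // cm1.
  have totE := total_below pY rY yY wE q1.
  have le : wcomp_le (\big[mmul/mone]_B q y B) rho.
    by move: ytop; rewrite totE wcomp_leM => /andP[].
  split=> // B; rewrite ffunE insubdK // mem_divisors_of.
  exact: wcomp_le_trans (wcomp_le_bigmul _ B) le.
have -> : \prod_(B in Y) hser (nblocks x B).-1 =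
    \prod_B Fps (fun m => (is_monom_h (deg B) m)%:R).
  rewrite big_mkcond; apply: eq_bigr => B _; rewrite /deg.
  by case: ifP => // _; rewrite -hser0.
rewrite coef_mul_prod_ind -[LHS]big_filter -[RHS]big_filter.
set L := [seq y <- _ | _]; set V := [seq d <- _ | _].
have inL y : y \in L -> y \in itv_fset x top /\ blocks y = Y.
  by rewrite mem_filter => /andP[/eqP].
rewrite [RHS](perm_big [seq psi y | y <- L]).
  rewrite big_map; apply: eq_big_seq => y /inL[yI yY].
  have [_ _ totE _ psiE] := qP y yI yY.
  by rewrite totE -divcm_divcm; congr (coef f (divcm _ _)); apply: eq_bigr.
have mbel B : B \in Y -> (mdeg (below x B) + deg B = #|B|.-1)%N.
  move=> BY; rewrite /deg BY -(mdeg_below pY rY BY).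
  by case: (nblocks x B) (nblocks_gt0 pY rY BY) => // k _; rewrite addnS.
apply: uniq_perm; first by rewrite filter_uniq ?index_enum_uniq.
  rewrite map_inj_in_uniq ?filter_uniq ?fset_uniq // => y y' /inL[yI yY] /inL[yI' yY'] e.
  have [wE _ _ _ psiE] := qP y yI yY; have [wE' _ _ _ psiE'] := qP y' yI' yY'.
  apply/val_inj/val_inj; rewrite [LHS]surjective_pairing [RHS]surjective_pairing.
  congr pair; first by rewrite -/(blocks y) -/(blocks y') yY yY'.
  apply/ffunP => B; rewrite -[LHS]/(weight y B) -[RHS]/(weight y' B).
  have [BY|BN] := boolP (B \in Y); last by rewrite !wpart_weight0 ?yY ?yY'.
  by rewrite wE // wE' // -psiE -psiE' e.
move=> d; rewrite mem_filter mem_index_enum andbT; apply/idP/mapP.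
  move=> /andP[/forallP ddeg dle].
  (* The preimage of [d] adds the extra weights [d B] to the weights coming from [x]. *)
  pose p : wpart_data G := (Y, [ffun B => if B \in Y then mmul (below x B) (val (d B)) else mone]).
  have pP : is_wpart p.
    apply/and3P; split=> //.
      apply/forall_inP => B BY; rewrite ffunE BY mdegM -mbel // eqn_add2l.
      exact: ddeg.
    by apply/forallP => B; apply/implyP => /= /negPf BN; rewrite ffunE BN.
  have pC : [forall B in blocks (WPart pP), connected_in B].
    by apply/forall_inP => B; apply: cY.
  pose y := GPart pC; have yY : blocks y = Y by [].
  have wE B : B \in Y -> weight y B = mmul (below x B) (val (d B)).
    by move=> BY; rewrite /weight /= ffunE BY.
  have d1 B : B \notin Y -> val (d B) = mone.
    move=> /negPf BN; apply/eqP; rewrite -mdeg_eq0; have := ddeg B.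
    by rewrite /is_monom_h /deg BN.
  have totE := total_below pY rY yY wE d1.
  have yI : y \in itv_fset x top.
    rewrite (mem_itv_fset (@finite_gpart_itv G)); apply/andP; split.
      rewrite -[(x <= y)%O]/(wpart_le x y) wpart_leE yY rY.
      by apply/forall_inP => B BY; rewrite wE // wcomp_le_mull.
    by rewrite le_top totE wcomp_leM xnu.
  have yL : y \in L by rewrite mem_filter yY eqxx.
  exists y => //; apply/ffunP => B; apply: val_inj.
  have [wqE q1 _ _ ->] := qP y yI yY.
  have [BY|BN] := boolP (B \in Y); last by rewrite d1 // q1.
  by rewrite /q wE // divcm_mul.
move=> [y /inL[yI yY] ->]; have [wE q1 totE le psiE] := qP y yI yY.
rewrite (eq_bigr _ (fun B _ => psiE B)) le andbT; apply/forallP => B.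
rewrite psiE /is_monom_h; have [BY|BN] := boolP (B \in Y); last first.
  by rewrite q1 // mdeg1 /deg (negPf BN).
have := wpart_mdeg (x := y) (B := B); rewrite yY => /(_ BY).
by rewrite wE // mdegM -mbel // => /eqP; rewrite eqn_add2l.
Qed.
End UpperInterval.

(** * The Moebius symmetric function of a path *)

(** Edges join consecutive vertices, so no edge inside [B] jumps over a missing vertex [j], and the
    vertices below [j] are closed under adjacency in [B]. Conversely, two vertices of a convex set
    are joined by steps of one. *)
Lemma path_connected_in n (B : {set 'I_n}) : @connected_in (path_graph n) B = convex B.
Proof.
pose e := [rel u v : 'I_n | [&& u \in B, v \in B & path_edge u v]].
have e_sym : connect_sym e.
  by apply: sym_connect_sym => u v /=; rewrite path_edge_sym andbCA.
have cE : @connected_in (path_graph n) B =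
    [forall i in B, forall k in B, connect e i k] by [].
rewrite cE; apply/forall_inP/convexP => [cB i j k iB kB ij jk|cB i iB].
  have /forall_inP/(_ k kB) ik := cB i iB; apply: contraT => jB.
  have lt_j u v : e u v -> (u < j)%N -> (v < j)%N.
    move=> /and3P[_ vB uv] uj; have vj : v != j by apply: contraNneq jB => <-.
    rewrite ltn_neqAle vj /=; case/orP: uv => /eqP uv; first by rewrite -uv.
    by rewrite ltnW // (leq_trans _ uj) // -uv.
  have cl : closed e [pred u : 'I_n | (u < j)%N].
    by apply: (intro_closed e_sym) => u v uv; rewrite !inE; exact: lt_j.
  have := closed_connect cl ik; rewrite !inE [in RHS]ltnNge jk ltn_neqAle ij andbT.
  by move/negbFE/eqP/val_inj => ij_; rewrite -ij_ iB in jB.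
suff main d i' k : i' \in B -> k \in B -> k = (i' + d)%N :> nat -> connect e i' k.
  apply/forall_inP => k kB; case: (leqP i k) => [ik|/ltnW ki].
    by apply: (main (k - i)%N); rewrite ?subnKC.
  by rewrite e_sym; apply: (main (i - k)%N); rewrite ?subnKC.
move: k; elim: d => [|d IHd] k i'B kB kE.
  by rewrite (_ : k = i') ?connect0 //; apply: val_inj; rewrite /= kE addn0.
have jn : (i' + d < n)%N by rewrite (leq_trans _ (ltnW (ltn_ord k))) // kE addnS.
have jB : Ordinal jn \in B.
  by apply: (cB i' _ k); rewrite ?leq_addr //= kE leq_add2l.
apply: connect_trans (IHd _ i'B jB erefl) (connect1 _).
by rewrite /= jB kB /path_edge /= kE addnS eqxx.
Qed.

(** * Coarsenings and Moebius values for partitions of a path *)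

Section PathMobius.
Variable n : nat.
Local Notation G := (path_graph n).
Implicit Types (x y : gpart G) (Y : {set {set 'I_n}}).

Lemma gpart_convex x (B : {set 'I_n}) : B \in blocks x -> convex B.
Proof. by rewrite -path_connected_in; case: x => x /= /forall_inP; apply. Qed.

(** The least elements of the blocks of [x]. *)
Definition starts x : {set 'I_n} := [set i | pblock (blocks x) i \subset tail n i].

Lemma starts_block x i j : i \in starts x -> j \in starts x ->
  pblock (blocks x) i = pblock (blocks x) j -> i = j.
Proof.
rewrite !inE => si sj e; apply/val_inj/eqP; rewrite eqn_leq.
have := subsetP si j; rewrite e pblock_block inE => /(_ isT) ->.
by have := subsetP sj i; rewrite -e pblock_block inE => /(_ isT) ->.
Qed.

Lemma min_of (B : {set 'I_n}) : B != set0 -> exists2 i, i \in B & B \subset tail n i.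
Proof.
case/set0Pn => i0 i0B.
case: (@arg_minnP _ i0 (mem B) (fun i => i : nat) i0B) => i iB imin.
by exists i => //; apply/subsetP => j jB; rewrite inE imin.
Qed.

Lemma block_start x (A : {set 'I_n}) : A \in blocks x ->
  exists2 i, i \in starts x & pblock (blocks x) i = A.
Proof.
move=> Ax; have [i iA Ai] := @min_of A (wpart_block_neq0 Ax).
have AE := def_pblock (partition_trivIset (wpart_partition x)) Ax iA.
by exists i => //; rewrite inE AE.
Qed.

Lemma card_starts x (B : {set 'I_n}) : (forall i, i \in B -> pblock (blocks x) i \subset B) ->
  #|starts x :&: B| = nblocks x B.
Proof.
move=> uB; rewrite -(@card_in_imset _ _ (pblock (blocks x))); last first.
  by move=> i j; rewrite !in_setI => /andP[si _] /andP[sj _]; apply: starts_block.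
apply: eq_card => A; apply/imsetP/setIdP => [[i /setIP[_ iB] ->]|[Ax AB]].
  by rewrite (pblock_block x i) uB.
have [i si iA] := block_start Ax; exists i => //.
by rewrite inE si (subsetP AB) // -iA pblock_block.
Qed.

Lemma boundary_starts0 x : boundary (starts x) 0.
Proof. by apply/boundaryP => i i0; rewrite inE; apply/subsetP => j _; rewrite inE i0. Qed.

(** If [Y] cut a block [A] of [x], some block of [Y] would start at a point of [A] other than its
    least element, and this point is not in [starts x]. *)
Lemma coarser_interval_parts x Y :
  [&& partition Y [set: 'I_n], refines (blocks x) Y & [forall B in Y, @connected_in G B]]
  = (Y \in interval_parts (starts x) 0).
Proof.
have t0 : tail n 0 = [set: 'I_n] by apply/setP => i; rewrite !inE.
apply/and3P/interval_partsP => [[pY rY /forall_inP cY]|[pY cY sY]].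
  split; [by rewrite t0|by move=> B BY; rewrite -path_connected_in cY|].
  move=> B i BY iB Bi; rewrite inE; apply: subset_trans Bi.
  exact: (@coarse_block G x Y pY rY i B BY iB).
rewrite t0 in pY; split=> //; last first.
  by apply/forall_inP => B /cY; rewrite -path_connected_in.
apply/forall_inP => A Ax; have [i si iA] := block_start Ax.
have inY j : (pblock Y j \in Y) * (j \in pblock Y j).
  have jY : j \in cover Y by rewrite (cover_partition pY) inE.
  by rewrite pblock_mem // mem_pblock.
apply/exists_inP; exists (pblock Y i); first by rewrite inY.
have tY := partition_trivIset pY; have tX := partition_trivIset (wpart_partition x).
apply/subsetP => j jA; apply: contraT => jB.
have ij : (i <= j)%N.
  by move: si; rewrite inE iA => /subsetP/(_ j jA); rewrite inE.
have [k kB' B'k] := min_of (partition_neq0 pY (inY j).1).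
have kj : (k <= j)%N by have := subsetP B'k j (inY j).2; rewrite inE.
have [ki|ik] := leqP k i.
  have iB' : i \in pblock Y j.
    by move/convexP: (cY _ (inY j).1); apply; [exact: kB'|exact: (inY j).2|exact: ki|exact: ij].
  by rewrite (def_pblock tY (inY j).1 iB') (inY j).2 in jB.
have kS := sY _ _ (inY j).1 kB' B'k.
have iAm : i \in A by rewrite -iA pblock_block.
have kA : k \in A.
  by move/convexP: (gpart_convex Ax) => /(_ i k j iAm jA (ltnW ik) kj).
have := subsetP (_ : pblock (blocks x) k \subset tail n k) i.
rewrite (def_pblock tX Ax kA) inE leqNgt ik => h.
by have := h _ iAm; move: kS; rewrite inE (def_pblock tX Ax kA) => -> /(_ isT).
Qed.

(** The candidate for [mu(y, top)] when [y] has [l] blocks, to be read at the monomial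
    [nu / total_weight y]. The exponent [l.+1] has the parity of [l - 1]. *)
Definition path_term l : fps := (-1) ^+ l.+1 * forest (fun m => eser m) 1 l.

(** The case of a single tree in [forest_compositions], whose hypothesis is [E(-t) H(t) = 1]. *)
Lemma sum_path_term k L : (k <= L)%N ->
  \sum_(l < L.+1) path_term l * compositions (fun m => hser m) l k = (k == 1%N)%:R.
Proof.
move=> kL; under eq_bigr do rewrite /path_term exprS mulN1r !mulNr -mulrA.
rewrite sumrN forest_compositions ?expr1 ?mulN1r ?opprK // => s.
rewrite -sum_sign_eser_hser; apply: eq_bigr => i _.
by rewrite -signr_odd mulr_sign -[in RHS]signr_odd scaler_sign.
Qed.

(** Grouping the [y] by their blocks, [sum_upper_interval] evaluates each group, and
    [sum_interval_parts] sums the groups into the left side of [sum_path_term]. By [mobius_dual],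
    this determines [mu(-, top)]. *)
Lemma sum_mobius_path x (top : gpart G) : blocks top = [set [set: 'I_n]] -> (x <= top)%O ->
  \sum_(y <- itv_fset x top)
    coef (path_term #|blocks y|) (divcm (weight top [set: 'I_n]) (total_weight y))
  = (x == top)%:R.
Proof.
move=> topE xtop; set nu := weight top _.
have n_gt0 : (0 < n)%N.
  have := wpart_block_neq0 (pi := top) (B := [set: 'I_n]).
  by rewrite topE inE eqxx -card_gt0 cardsT card_ord => /(_ isT).
have inI y : y \in itv_fset x top -> blocks y \in interval_parts (starts x) 0.
  rewrite (mem_itv_fset (@finite_gpart_itv G)) => /andP[xy _].
  rewrite -coarser_interval_parts wpart_partition.
  move: xy; rewrite -[(x <= y)%O]/(wpart_le x y) wpart_leE => /andP[-> _] /=.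
  by case: (y) => y' /=.
rewrite big_seq_cond (partition_big (fun y : gpart G => blocks y)
  (mem (interval_parts (starts x) 0))) /=; last by move=> y; rewrite andbT; apply: inI.
transitivity (\sum_(Y in interval_parts (starts x) 0)
    coef (path_term #|Y| * \prod_(B in Y) hser #|starts x :&: B|.-1) (divcm nu (total_weight x))).
  apply: eq_bigr => Y YI; have := YI; rewrite -coarser_interval_parts.
  move=> /and3P[pY rY /forall_inP cY].
  transitivity (\sum_(y <- itv_fset x top | blocks y == Y)
      coef (path_term #|Y|) (divcm nu (total_weight y))).
    rewrite [RHS]big_seq_cond; apply: eq_big => [y|y /andP[_ /eqP ->//]].
    by rewrite andbT.
  rewrite (@sum_upper_interval G x top topE xtop _ Y pY rY cY).
  congr coef; congr (_ * _); apply: eq_bigr => B BY.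
  by rewrite card_starts // => i; apply: coarse_block BY.
rewrite -fps_coef_sum (sum_interval_parts (fun m => hser m) path_term (leq0n n)
  (boundary_starts0 x) (leqnn _)) sum_path_term //.
have -> : rank_from (starts x) 0 = #|blocks x|.
  rewrite /rank_from (card_starts (B := tail n 0)).
    apply: eq_card => A; rewrite inE; case: (A \in blocks x) => //=.
    by apply/subsetP => i; rewrite inE.
  by move=> i _; apply/subsetP => j; rewrite !inE.
have degx := mdeg_total x; rewrite card_ord in degx.
have degnu : mdeg nu = n.-1.
  by rewrite (wpart_mdeg (x := top)) ?topE ?inE // cardsT card_ord.
have xnu : wcomp_le (total_weight x) nu by rewrite -(le_top topE).
(* The left side is now the coefficient of [nu / total_weight x] in 1 or 0, according to whether [x]
   has one block. A one-block [x] below [top] has a weight of the same degree as [nu], hence equals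
   [top]. *)
case: (eqVneq x top) => [->|xNtop].
  rewrite topE cards1 eqxx mulr1n Defs.coef1.
  have -> : total_weight top = nu by rewrite /total_weight topE big_set1.
  suff -> : divcm nu nu = mone by rewrite eqxx.
  by apply: wcompP => i; rewrite divcmE subnn cm1.
case: eqP => [k1|_]; last by rewrite mulr0n.
case/eqP: xNtop.
have totE : total_weight x = nu.
  apply: wcomp_le_deg_eq => //; rewrite degnu.
  by move: degx; rewrite k1 addn1 => /(congr1 predn).
have [B xE] := cards1P (introT eqP k1).
have BT : B = [set: 'I_n].
  by rewrite -(cover_partition (wpart_partition x)) xE /cover big_set1.
rewrite BT in xE.
apply/val_inj/val_inj; rewrite [LHS]surjective_pairing [RHS]surjective_pairing.
congr pair; first by rewrite -/(blocks x) -/(blocks top) xE topE.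
apply/ffunP => C; rewrite -[LHS]/(weight x C) -[RHS]/(weight top C).
have [CT|CN] := boolP (C \in [set [set: 'I_n]]); last by rewrite !wpart_weight0 ?xE ?topE.
by move/set1P: CT => ->; rewrite -/nu -totE /total_weight xE big_set1.
Qed.

(** A forest with [k] trees and [m] nodes has [m - k] edges, and a node with [j] children
    contributes degree [j]. *)
Lemma coef_forest_homog k m nu : (mdeg nu + k != m)%N ->
  coef (forest (fun j => eser j) k m) nu = 0.
Proof.
elim: m k nu => [|m IHm] [|k] nu //=.
  by rewrite addn0 mdeg_eq0 => /negPf ->.
move=> nukm; rewrite fps_coef_sum big1 // => j _; rewrite Defs.coefM big1_seq // => -[a b].
rewrite mem_splits /= => /eqP abE; rewrite /is_monom_e; case: eqP => [aj|_]; last by rewrite mul0r.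
rewrite IHm ?mulr0 //; apply: contraNneq nukm => <-.
by rewrite -abE mdegM -aj addnS -addnA addnC -addnA.
Qed.

(** At [hat0] there are [n] blocks and the total weight is 1, so [mu(hat0, top)] is the coefficient
    of [nu] in [path_term n]. *)
Lemma mobius_sym_path : (0 < n)%N ->
  (-1) ^+ n.-1 *: mobius_sym G = forest (fun m => eser m) 1 n.
Proof.
move=> n_gt0; apply: fpsP => nu; rewrite Defs.coefZ /=.
have conn : @connected_in G [set: 'I_n].
  by rewrite path_connected_in; apply/convexP => i j k; rewrite !inE.
have := one_blockE G nu; rewrite conn card_ord n_gt0 /=.
case E : (one_block G nu) => [top|] /= degnu; last first.
  (* Here [{V^nu}] is not in the poset, so the degree of [nu] is not [n - 1] and the forest series
     has coefficient 0 as well. *)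
  rewrite mulr0 coef_forest_homog //; apply/eqP => e.
  by move: degnu; rewrite -e addn1 eqxx.
have topP : (blocks top = [set [set: 'I_n]]) * (weight top [set: 'I_n] = nu).
  move: E; rewrite /one_block; case: insubP => //= p _ pE; case: insubP => //= q _ qE [<-].
  by rewrite /blocks /weight qE pE /= ffunE eqxx.
rewrite (mobius_dual (@finite_gpart_itv G) (fun x => @sum_mobius_path x top topP.1) (hat0_le _)).
have -> : #|blocks (hat0 G)| = n.
  have -> : blocks (hat0 G) = [set [set i] | i in [set: 'I_n]] by [].
  by rewrite card_imset ?cardsT ?card_ord //; exact: set1_inj.
have -> : total_weight (hat0 G) = mone.
  by rewrite /total_weight big1 // => B _; rewrite /weight /= ffunE.
have -> : divcm (weight top [set: 'I_n]) mone = nu.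
  by apply: wcompP => i; rewrite topP divcmE cm1 subn0.
have sgn : (-1) ^+ n.+1 = (-1) ^+ n.-1 :> fps.
  by rewrite -[in LHS](prednK n_gt0) !exprS !mulN1r opprK.
rewrite /path_term sgn -signr_odd mulr_sign -[(-1) ^+ n.-1]signr_odd.
by case: odd; rewrite ?Defs.coefN ?expr1 ?expr0 ?mulN1r ?mul1r ?opprK.
Qed.
End PathMobius.

(** * Burnside's lemma and power sums *)

Lemma symf_val_prod (I : Type) (r : seq I) (P : pred I) (F : I -> symf) :
  symf_val (\prod_(i <- r | P i) F i) = \prod_(i <- r | P i) symf_val (F i).
Proof. exact: (rmorph_prod (val : {rmorphism symf -> fps})). Qed.

Lemma symf_val_sum (I : Type) (r : seq I) (P : pred I) (F : I -> symf) :
  symf_val (\sum_(i <- r | P i) F i) = \sum_(i <- r | P i) symf_val (F i).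
Proof. exact: (raddf_sum (val : {rmorphism symf -> fps})). Qed.

Lemma symf_valZ (c : rat) (f : symf) : symf_val (c *: f) = c *: symf_val f.
Proof. by []. Qed.

(** * Words up to rearrangement *)

Section Relabelling.
Variables (n : nat) (T : finType).

Definition relabel (g : {ffun 'I_n -> T}) (w : 'S_n) : {ffun 'I_n -> T} :=
  [ffun i => g ((w^-1)%g i)].

Lemma relabel1 : relabel^~ 1%g =1 id.
Proof. by move=> g; apply/ffunP => i; rewrite ffunE invg1 perm1. Qed.

Lemma relabelM g : act_morph relabel g.
Proof. by move=> v w; apply/ffunP => i; rewrite !ffunE invMg permM. Qed.

Lemma relabel_eqP (g g' : {ffun 'I_n -> T}) :
  (forall t, #|[set j | g j == t]| = #|[set j | g' j == t]|) -> exists w, relabel g w = g'.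
Proof.
have cnt (f : {ffun 'I_n -> T}) t : count_mem t [tuple f j | j < n] = #|[set j | f j == t]|.
  rewrite -sum1_count big_tuple -sum1_card; apply: eq_big => [j|//].
  by rewrite inE tnth_mktuple.
move=> gg'; have /tuple_permP[p gp] : perm_eq [tuple g' j | j < n] [tuple g j | j < n].
  by apply/allP => t _ /=; rewrite !cnt gg'.
exists (p^-1)%g; apply/ffunP => i; rewrite ffunE invgK.
have /(congr1 (fun s => nth (g i) s i)) := gp.
by rewrite -!tnth_nth !tnth_mktuple.
Qed.

(** Concatenate [m t] copies of each value [t] into a word of length [n]. *)
Lemma exists_preim (m : T -> nat) : (\sum_t m t)%N = n ->
  exists g : {ffun 'I_n -> T}, forall t, #|[set j | g j == t]| = m t.
Proof.
pose s := flatten [seq nseq (m t) t | t <- enum T].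
move=> mn; have /eqP sn : size s == n.
  by rewrite size_flatten /shape -map_comp sumnE big_map big_enum -[X in _ == X]mn;
    apply/eqP; apply: eq_bigr => t _; rewrite /= size_nseq.
pose tp := @Tuple n T s (introT eqP sn).
exists [ffun j => tnth tp j] => t.
transitivity (count_mem t s).
  rewrite -sum1_count -[s]/(tval tp) big_tuple -sum1_card; apply: eq_big => [j|//].
  by rewrite inE ffunE.
rewrite count_flatten -map_comp sumnE big_map big_enum /= (bigD1 t) //=.
rewrite count_nseq /= eqxx mul1n big1 ?addn0 // => u /negPf ut.
by rewrite count_nseq /= ut.
Qed.

End Relabelling.

(** As [inv] separates exactly the orbits on [S], its values count them, and Burnside's lemma
    applies. *)
Lemma burnside_invariant (gT : finGroupType) (X U : finType)
    (to : {action gT &-> X}) (S : {set X}) (inv : X -> U) :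
    (forall x w, x \in S -> to x w \in S) ->
    {in S &, forall x y, inv x = inv y <-> exists w, to x w = y} ->
  (\sum_(w : gT) #|[set x in S | to x w == x]| = #|inv @: S| * #|gT|)%N.
Proof.
move=> Sto invE; have actS : [acts [set: gT], on S | to].
  apply/subsetP => w _; rewrite !inE /=; apply/subsetP => x xS.
  by rewrite inE Sto.
have := Frobenius_Cauchy actS; rewrite cardsT => FC.
transitivity (\sum_(a in [set: gT]) #|('Fix_(S | to)[a])%g|)%N.
  apply: eq_big => [w|w _]; first by rewrite inE.
  by apply: eq_card => x; rewrite in_setI [in LHS]inE; congr (_ && _); apply/eqP/afix1P.
rewrite FC; congr (_ * _)%N.
(* The orbit of any point with invariant [u]; the default [set0] occurs only for values not taken on
   [S]. *)
pose h (u : U) := if [pick x in S | inv x == u] is Some x then orbit to [set: gT] x else set0.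
rewrite -(@card_in_imset _ _ h (mem (inv @: S))); last first.
  move=> _ _ /imsetP[x xS ->] /imsetP[y yS ->]; rewrite /h.
  case: pickP => [x' /andP[x'S /eqP xx']|/(_ x)]; last by rewrite /= xS eqxx.
  case: pickP => [y' /andP[y'S /eqP yy']|/(_ y)]; last by rewrite /= yS eqxx.
  move/esym/orbit_eqP/orbitP => [w _ wE]; rewrite -xx' -yy'.
  by apply/(invE _ _ x'S y'S); exists w.
have hE x : x \in S -> h (inv x) = orbit to [set: gT] x.
  move=> xS; rewrite /h; case: pickP => [y /andP[yS /eqP yx]|/(_ x)]; last by rewrite /= xS eqxx.
  have [w <-] := (invE _ _ yS xS).1 yx.
  by apply/esym/orbit_eqP; rewrite mem_orbit ?inE.
apply: eq_card => O; apply/imsetP/imsetP => [[x xS ->]|[_ /imsetP[x xS ->] ->]].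
  by exists (inv x); rewrite ?hE ?imset_f.
by exists x; rewrite ?hE.
Qed.

Lemma trace_perm_repr (gT : finGroupType) (T : finType) (to : {action gT &-> T}) w :
  \tr (perm_repr to w) = #|[set t | to t w == t]|%:R.
Proof.
rewrite /mxtrace -sum1_card natr_sum.
rewrite [RHS](eq_bigl (fun t => (t \in T) && (to t w == t))); last by move=> t; rewrite inE.
rewrite big_mkcondr /= (big_enum_val (fun t => if to t w == t then 1 else 0)).
by apply: eq_bigr => i _; rewrite mxE; case: eqP.
Qed.

Lemma partition_porbits (T : finType) (w : {perm T}) : partition (porbits w) [set: T].
Proof.
apply/and3P; split.
- apply/eqP/setP => t; rewrite inE; apply/bigcupP; exists (porbit w t); last exact: porbit_id.
  exact: imset_f.
- apply/trivIsetP => _ _ /imsetP[x _ ->] /imsetP[y _ ->] xy.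
  rewrite -setI_eq0; apply: contraNT xy => /set0Pn[z /setIP[]].
  by rewrite -!eq_porbit_mem => /eqP-> /eqP->.
- by apply/imsetP => -[x _] /setP/(_ x); rewrite porbit_id inE.
Qed.

(** * Contents of colourings and products of power sums *)

Section Contents.
Variable (nu : wcomp).
Local Notation K := (finsupp nu).
Local Notation D := (divisors_of nu).

(** Colours are the indices of the variables in [nu]: a colouring with content [nu] uses no others,
    and they form a finite type. *)
Definition content (J : finType) (P : pred J) (k : J -> K) : wcomp :=
  \big[mmul/mone]_(j | P j) ucm (val (k j)).

Lemma contentE (J : finType) (P : pred J) (k : J -> K) i :
  content P k i = #|[set j | P j && (val (k j) == i)]|.
Proof.
rewrite wcomp_prodE -sum1_card big_mkcond [RHS]big_mkcond; apply: eq_bigr => j _.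
by rewrite inE cmU; case: (P j) => //=; case: eqP.
Qed.

Lemma mdeg_content (J : finType) (P : pred J) (k : J -> K) : mdeg (content P k) = #|[set j | P j]|.
Proof.
rewrite mdeg_prod -sum1_card; apply: eq_big => [j|j _]; first by rewrite inE.
exact: mdegU.
Qed.

Lemma divisors_of1 : mone \in D.
Proof. by rewrite mem_divisors_of; apply/wcomp_leP => i; rewrite cm1. Qed.

Definition to_divisor (m : wcomp) : D := insubd [` divisors_of1]%fset m.

Lemma to_divisorK m : wcomp_le m nu -> val (to_divisor m) = m.
Proof. by move=> mnu; rewrite insubdK // mem_divisors_of. Qed.

Variables (n : nat).

(** A colouring is fixed by [w] when it is constant on each cycle. Giving colour [i] to a cycle [c]
    corresponds to choosing the monomial [x_i^#|c|] of the power sum for [c]. *)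
Lemma coef_prod_power_sums (w : 'S_n) :
  coef (symf_val (\prod_(c in porbits w) symf_p #|c|)) nu =
  #|[set k : {ffun 'I_n -> K} | (relabel k w == k) && (content predT k == nu)]|%:R.
Proof.
(* Allowing only the monomial 1 off the cycles turns the product into one over all subsets. *)
pose b (c : {set 'I_n}) : pred wcomp :=
  fun m => if c \in porbits w then is_monom_p #|c| m else m == mone.
have -> : symf_val (\prod_(c in porbits w) symf_p #|c|) = \prod_c Fps (fun m => (b c m)%:R).
  rewrite symf_val_prod big_mkcond; apply: eq_bigr => c _.
  rewrite /b; case: ifP => //= cw.
rewrite coef_prod_ind; congr _%:R; apply/esym.
set S := [set k | _]; set V := [set d | _].
have pP := partition_porbits w.
have block (k : {ffun 'I_n -> K}) :
    \big[mmul/mone]_(c in porbits w) content (fun j => j \in c) k = content predT k.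
  rewrite /content -(set_partition_big _ pP); apply: eq_bigl => j; by rewrite inE.
pose q (k : {ffun 'I_n -> K}) c := if c \in porbits w then content (fun j => j \in c) k else mone.
pose psi (k : {ffun 'I_n -> K}) : {ffun {set 'I_n} -> D} := [ffun c => to_divisor (q k c)].
have qprod k : k \in S -> \big[mmul/mone]_c q k c = nu.
  by rewrite inE => /andP[_ /eqP <-]; rewrite -block [RHS]big_mkcond.
have psiE k c : k \in S -> val (psi k c) = q k c.
  move=> kS; rewrite ffunE to_divisorK // -[X in wcomp_le _ X](qprod k kS).
  exact: wcomp_le_bigmul.
have kconst k i j : k \in S -> j \in porbit w i -> k j = k i.
  rewrite inE => /andP[/eqP kw _] /porbitP[e ->]; elim: e => [|e IHe].
    by rewrite expg0 perm1.
  by rewrite expgSr permM -{1}kw ffunE permK.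
have qE k i x : k \in S -> q k (porbit w i) x = (#|porbit w i| * (val (k i) == x))%N.
  move=> kS; rewrite /q imset_f // contentE.
  case: eqVneq => [e|/negPf ne]; rewrite ?muln1 ?muln0.
    apply: eq_card => j; rewrite inE; case: (boolP (j \in _)) => // ji.
    by rewrite (kconst k i j) // e eqxx.
  apply/eqP; rewrite cards_eq0; apply/eqP/setP => j; rewrite !inE.
  by case: (boolP (j \in _)) => // ji; rewrite (kconst k i j) // ne.
have pos i : (0 < #|porbit w i|)%N by apply/card_gt0P; exists i; exact: porbit_id.
rewrite -(@card_in_imset _ _ psi (mem S)); last first.
  move=> k k' kS k'S e; apply/ffunP => i; apply/val_inj/eqP.
  have := qE k' i (val (k i)) k'S; rewrite -psiE // -e psiE // qE // eqxx muln1.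
  by case: eqVneq => [e' _|_ /eqP]; [apply/eqP|rewrite muln0 eqn0Ngt pos].
apply: eq_card => d; rewrite inE; apply/esym; apply/idP/imsetP; last first.
  move=> [k kS ->]; rewrite (eq_bigr (q k)) ?qprod ?eqxx ?andbT // => [|c _]; last exact: psiE.
  apply/forallP => c; rewrite psiE // /b.
  have [/imsetP[i _ ->]|cN] := boolP (c \in porbits w); last by rewrite /q (negPf cN).
  have -> : q k (porbit w i) = content (fun j => j \in porbit w i) k by rewrite /q imset_f.
  rewrite /is_monom_p mdeg_content.
  rewrite (_ : [set j | _] = porbit w i); last by apply/setP => j; rewrite in_set.
  rewrite eqxx /=; apply/eqP; rewrite -[RHS](cardfs1 (val (k i))); congr #|` _|.
  apply/fsetP => x; rewrite -cmE_neq0 in_fset1.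
  have := qE k i x kS; rewrite /q imset_f // => ->.
  by rewrite muln_eq0 negb_or -lt0n pos eqb0 negbK [RHS]eq_sym.
move=> /andP[/forallP bd /eqP dprod].
have dP i : is_monom_p #|porbit w i| (val (d (porbit w i))).
  by have := bd (porbit w i); rewrite /b imset_f.
(* The monomial chosen for the cycle of [i] involves a single variable, which becomes the colour of
   [i]. *)
have /fin_all_exists[k kP] : forall i, exists u : K,
    finsupp (val (d (porbit w i))) = [fset val u]%fset.
  move=> i; have /andP[_ /cardfs1P[u uE]] := dP i.
  have uK : u \in K.
    rewrite -cmE_neq0 -lt0n; have /wcomp_leP/(_ u) := divisors_of_le (d (porbit w i)).
    by apply: leq_trans; rewrite lt0n cmE_neq0 uE in_fset1.
  by exists [` uK]%fset.
have kP' i j : j \in porbit w i -> k j = k i.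
  rewrite -eq_porbit_mem => /eqP ji; have := kP j; rewrite ji kP => /fset1_inj e.
  exact/val_inj/esym.
have dE i x : val (d (porbit w i)) x = (#|porbit w i| * (val (k i) == x))%N.
  case: eqVneq => [<-|/negPf ne]; rewrite ?muln1 ?muln0.
    by have /andP[/eqP <- _] := dP i; rewrite mdegE kP big_seq_fset1.
  by apply/eqP; rewrite cmE_eq0 kP in_fset1 eq_sym ne.
pose k' : {ffun 'I_n -> K} := [ffun i => k i].
have qd c : q k' c = val (d c).
  rewrite /q; case: ifPn => [/imsetP[i _ ->]|cN]; last first.
    by have := bd c; rewrite /b (negPf cN) => /eqP.
  apply: wcompP => x; rewrite dE contentE.
  case: eqVneq => [e|/negPf ne]; rewrite ?muln1 ?muln0.
    apply: eq_card => j; rewrite inE ffunE; case: (boolP (j \in _)) => // ji.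
    by rewrite (kP' i j) // e eqxx.
  apply/eqP; rewrite cards_eq0; apply/eqP/setP => j; rewrite !inE ffunE.
  by case: (boolP (j \in _)) => // ji; rewrite (kP' i j) // ne.
have kS : k' \in S.
  rewrite inE -block; apply/andP; split; last first.
    apply/eqP; apply: etrans dprod; rewrite big_mkcond.
    by apply: eq_bigr => c _; rewrite -qd.
  apply/eqP/ffunP => i; rewrite !ffunE; apply: kP'.
  by rewrite porbit_sym; have := mem_porbit w 1 ((w^-1)%g i); rewrite expg1 permKV.
by exists k' => //; apply/ffunP => c; apply: val_inj; rewrite psiE // qd.
Qed.

End Contents.

(** * The parking function symmetric function *)

Lemma sorted_nth_leq (s : seq nat) i v : sorted leq s -> (i < size s)%N ->
  (nth 0%N s i <= v)%N = (i < count (fun u => u <= v) s)%N.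
Proof.
elim: s i => [|u s IHs] // i /= us; have su := path_sorted us.
have uall := order_path_min leq_trans us.
have [uv|vu] := leqP u v; last first.
  move=> lt_i; rewrite (@eq_in_count _ _ pred0) ?count_pred0; last first.
    by move=> t ts; apply/negbTE; rewrite -ltnNge (leq_trans vu) // (allP uall).
  case: i lt_i => [_|i lt_i]; rewrite /= leqNgt ?vu //.
  by rewrite (leq_trans vu) // (allP uall) // mem_nth.
by case: i => [|i] lt_i /=; rewrite ?uv // IHs.
Qed.

(** Counting from 1, the [i]-th smallest entry is at most [i] exactly when at least [i] entries are,
    that is, when the first [i] fibre sizes add up to at least [i]. All fibre sizes together add up
    to [n] for any [f]. *)
Lemma is_parking_ballot n (f : {ffun 'I_n -> 'I_n}) (a : {ffun 'I_n -> 'I_n.+1}) :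
  (forall i, a i = #|[set j | f j == i]| :> nat) -> is_parking f = ballot 1 a.
Proof.
move=> aE.
have sumE (P : pred 'I_n) : (\sum_(i | P i) a i)%N = #|[set j | P (f j)]|.
  rewrite -sum1_card [RHS](partition_big f P) /=; last by move=> j; rewrite inE.
  apply: eq_bigr => i Pi; rewrite aE -sum1_card; apply: eq_bigl => j.
  by rewrite !inE; case: eqP => [->|]; rewrite ?Pi ?andbF.
rewrite /ballot sumE add1n.
have -> : [set j : 'I_n | true] = setT by apply/setP => j; rewrite !inE.
rewrite cardsT card_ord eqxx andbT; apply: eq_forallb => i.
rewrite sorted_nth_leq; last 2 first.
- exact: sort_sorted leq_total _.
- by rewrite size_sort size_map -cardE card_ord.
have -> : count (fun u => u <= i.+1)%N (sort leq [seq (f j).+1 | j : 'I_n]) =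
    #|[set j | (f j <= i)%N]|.
  rewrite count_sort count_map -sum1_count big_enum_cond -sum1_card.
  by apply: eq_bigl => j; rewrite inE.
by rewrite sumE add1n ltnS.
Qed.

(** * Orbits of coloured parking functions *)

Section ParkingColourings.
Variables (n : nat) (nu : wcomp).
Local Notation K := (finsupp nu).
Local Notation D := (divisors_of nu).
Local Notation X := (parking n * {ffun 'I_n -> K})%type.

Definition colouring_act (x : X) (w : 'S_n) : X := (parking_perm x.1 w, relabel x.2 w).

Lemma colouring_act1 : colouring_act^~ 1%g =1 id.
Proof. by case=> p k; rewrite /colouring_act /= parking_perm1 relabel1. Qed.

Lemma colouring_actM x : act_morph colouring_act x.
Proof.
by case: x => p k v w; rewrite /colouring_act /= parking_permM relabelM.
Qed.

Definition colouring_action := TotalAction colouring_act1 colouring_actM.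

Definition colourings : {set X} := [set x : X | content predT x.2 == nu].

Definition part (x : X) (i : 'I_n) : wcomp := content (fun j => x.1 j == i) x.2.

Lemma prod_part x : \big[mmul/mone]_i part x i = content predT x.2.
Proof. by rewrite /part /content [RHS](partition_big x.1 predT). Qed.

Definition parts (x : X) : {ffun 'I_n -> D} := [ffun i => to_divisor nu (part x i)].

Lemma partsE x i : x \in colourings -> val (parts x i) = part x i.
Proof.
rewrite inE -prod_part => /eqP xnu; rewrite ffunE to_divisorK // -[X in wcomp_le _ X]xnu.
exact: wcomp_le_bigmul.
Qed.

Lemma part_act x w i : part (colouring_act x w) i = part x i.
Proof.
rewrite /part /content (reindex_inj (@perm_inj _ w)).
by apply: eq_big => [j|j _]; rewrite !ffunE permK.
Qed.

Lemma colourings_act x w : x \in colourings -> colouring_act x w \in colourings.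
Proof.
rewrite !inE -!prod_part => /eqP <-; apply/eqP.
by apply: eq_bigr => i _; rewrite part_act.
Qed.

(** The contents of the fibres tell how many positions have a given entry and a given colour. These
    are the fibre sizes of the word of pairs [g], which determine it up to relabelling. *)
Lemma parts_eqP : {in colourings &, forall x y,
  parts x = parts y <-> exists w, colouring_act x w = y}.
Proof.
move=> x y xS yS; split=> [xy|[w <-]]; last first.
  by apply/ffunP => i; rewrite !ffunE part_act.
pose g (z : X) : {ffun 'I_n -> 'I_n * K} := [ffun j => (z.1 j, z.2 j)].
have gE (z : X) i (k : K) : #|[set j | g z j == (i, k)]| = part z i (val k).
  by rewrite contentE; apply: eq_card => j; rewrite !inE ffunE xpair_eqE.
have [w gw] : exists w, relabel (g x) w = g y.
  by apply: relabel_eqP => -[i k]; rewrite !gE -!partsE // xy.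
exists w; move/ffunP: gw => gw.
case: y {xS yS xy} gw => [p k] gw; rewrite /colouring_act; congr pair.
  by apply/val_inj/ffunP => i; have := gw i; rewrite !ffunE => -[].
by apply/ffunP => i; have := gw i; rewrite !ffunE => -[].
Qed.

(** The trace of [w] counts the fixed parking functions and the power sums count the fixed
    colourings of content [nu], so the sum over [w] counts fixed pairs and Burnside's lemma gives
    the number of orbits. *)
Lemma coef_PFsym_colourings : coef (symf_val (PFsym n)) nu = #|parts @: colourings|%:R.
Proof.
have fact_neq0 : n`!%:R != 0 :> rat by rewrite pnatr_eq0 -lt0n fact_gt0.
rewrite /PFsym /frobenius_char symf_valZ symf_val_sum Defs.coefZ fps_coef_sum.
apply: (mulfI fact_neq0); rewrite mulVKf // mulrC -natrM.
have := @burnside_invariant _ _ _ colouring_action colourings parts colourings_act parts_eqP.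
rewrite card_Sn => <-; rewrite natr_sum; apply: eq_bigr => w _.
rewrite symf_valZ Defs.coefZ trace_perm_repr coef_prod_power_sums -natrM -cardsX.
congr _%:R; apply: eq_card => -[p k]; rewrite !inE /= xpair_eqE /=.
by case: (_ == p) => //=; rewrite andbC.
Qed.

(** Since [ballot] takes ordinal values, the degrees are supplied through a witness [a], which they
    determine. *)
Definition degree_ballot (d : {ffun 'I_n -> D}) : bool :=
  [exists a : {ffun 'I_n -> 'I_n.+1}, ballot 1 a && [forall i, mdeg (val (d i)) == a i]].

(** Conversely, the exponent of [u] in [d i] prescribes how many positions get entry [i] and colour
    [u]. A word of pairs with these fibre sizes exists, and its entries form a parking function by
    the ballot condition. *)
Lemma parts_colourings : parts @: colourings =
  [set d : {ffun 'I_n -> D} | degree_ballot d && (\big[mmul/mone]_i val (d i) == nu)].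
Proof.
apply/setP => d; rewrite inE; apply/imsetP/andP =>
    [[x xS ->]|[/existsP[a /andP[ba /forallP da]] /eqP dnu]].
  rewrite (eq_bigr (part x)) => [|i _]; last exact: partsE.
  rewrite prod_part; split; last by move: xS; rewrite inE.
  pose a : {ffun 'I_n -> 'I_n.+1} := [ffun i => inord #|[set j | x.1 j == i]|].
  have aE i : a i = #|[set j | x.1 j == i]| :> nat.
    by rewrite ffunE inordK // ltnS -[X in (_ <= X)%N]card_ord max_card.
  apply/existsP; exists a; rewrite -(is_parking_ballot aE) (valP x.1) /=.
  by apply/forallP => i; rewrite partsE // mdeg_content aE.
(* The final equation of [ballot], with [k = 1], makes the degrees add up to [n]. *)
have sum_d : (\sum_(t : 'I_n * K) val (d t.1) (val t.2))%N = n.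
  rewrite -(pair_bigA _ (fun i (k : K) => val (d i) (val k))) /=.
  have /andP[_ /eqP] := ba; rewrite add1n => -[an]; rewrite -[RHS]an.
  apply: eq_bigr => i _; rewrite -(eqP (da i)).
  rewrite (@mdegEw _ _ K); last first.
    apply/fsubsetP => k; rewrite -!cmE_neq0 -!lt0n => /leq_trans; apply.
    by have /wcomp_leP := divisors_of_le (d i); apply.
  by rewrite [RHS]big_seq_fsetE.
have [g gE] := exists_preim sum_d.
pose f : {ffun 'I_n -> 'I_n} := [ffun j => (g j).1].
pose k : {ffun 'I_n -> K} := [ffun j => (g j).2].
have contE i : content (fun j => f j == i) k = val (d i).
  apply: wcompP => u; rewrite contentE.
  have [uK|uN] := boolP (u \in K).
    rewrite -[u in RHS]/(val [` uK]%fset) -(gE (i, [` uK]%fset)).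
    by apply: eq_card => j; rewrite !inE !ffunE -pair_eqE /= -val_eqE.
  have -> : val (d i) u = 0%N.
    apply/eqP; rewrite -leqn0; have /wcomp_leP/(_ u) := divisors_of_le (d i).
    by move=> /leq_trans; apply; rewrite leqn0 cmE_eq0.
  apply/eqP; rewrite cards_eq0; apply/eqP/setP => j; rewrite !inE.
  by apply/negbTE; apply: contraNN uN => /andP[_ /eqP <-]; exact: valP.
have pf : is_parking f.
  rewrite (@is_parking_ballot _ f a) // => i.
  by rewrite -(eqP (da i)) -contE mdeg_content.
pose x : X := (Parking pf, k).
have xS : x \in colourings.
  by rewrite inE -prod_part -[X in _ == X]dnu; apply/eqP; apply: eq_bigr => i _; exact: contE.
by exists x => //; apply/ffunP => i; apply: val_inj; rewrite partsE // -contE.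
Qed.

(** Only the degrees of [d] can serve as [a], so each [d] is counted once. *)
Lemma coef_sum_ballot :
  coef (\sum_(a : {ffun 'I_n -> 'I_n.+1} | ballot 1 a) \prod_i hser (a i)) nu =
  #|[set d : {ffun 'I_n -> D} | degree_ballot d && (\big[mmul/mone]_i val (d i) == nu)]|%:R.
Proof.
rewrite fps_coef_sum.
transitivity (\sum_(a : {ffun 'I_n -> 'I_n.+1} | ballot 1 a) \sum_(d : {ffun 'I_n -> D})
    ([forall i, mdeg (val (d i)) == a i] && (\big[mmul/mone]_i val (d i) == nu))%:R : rat).
  apply: eq_bigr => a _.
  rewrite (coef_prod_ind (fun i => is_monom_h (a i))) -sum1_card natr_sum big_mkcond.
  by apply: eq_bigr => d _; rewrite inE; case: andb.
rewrite exchange_big -sum1_card natr_sum [RHS]big_mkcond /=; apply: eq_bigr => d _.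
rewrite inE; have [_|] := boolP (_ == nu); last first.
  by move=> _; rewrite andbF big1 // => a _; rewrite andbF.
rewrite andbT; under eq_bigr do rewrite andbT.
have [/existsP[a /andP[ba /forallP da]]|/existsPn nd] := boolP (degree_ballot d).
  rewrite (bigD1 a) //= (introT forallP) // big1 ?addr0 // => a' /andP[_ /eqP a'N].
  case: forallP => // da'; case: a'N; apply/ffunP => i; apply: val_inj => /=.
  by rewrite -(eqP (da i)) -(eqP (da' i)).
by rewrite big1 // => a ba; have := nd a; rewrite ba /= => /negPf ->.
Qed.
End ParkingColourings.

Lemma PFsym_complete n :
  PFsym n = \sum_(a : {ffun 'I_n -> 'I_n.+1} | ballot 1 a) \prod_i symf_h (a i).
Proof.
have sumE : symf_val (\sum_(a : {ffun 'I_n -> 'I_n.+1} | ballot 1 a) \prod_i symf_h (a i)) =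
    \sum_(a : {ffun 'I_n -> 'I_n.+1} | ballot 1 a) \prod_i hser (a i).
  by rewrite symf_val_sum; apply: eq_bigr => a _; rewrite symf_val_prod.
apply: val_inj; apply: etrans (esym sumE); apply: fpsP => nu.
by rewrite coef_sum_ballot -parts_colourings -coef_PFsym_colourings.
Qed.

(** As a ring morphism, [omega] turns each product of [h] into the corresponding product of [e]. The
    ballot words with [k = 1] then sum to plane trees, the omitted leaf having weight [e_0 = 1]. *)
Lemma omega_PFsym n (omega : {rmorphism symf -> symf}) :
    (forall m, omega (symf_h m) = symf_e m) ->
  symf_val (omega (PFsym n)) = forest (fun m => eser m) 1 n.+1.
Proof.
move=> omegaE; rewrite PFsym_complete rmorph_sum symf_val_sum.
rewrite -(@sum_ballot _ (fun m => eser m) n.+1) ?eser0 //.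
apply: eq_bigr => a _; rewrite rmorph_prod symf_val_prod.
by apply: eq_bigr => i _; rewrite omegaE.
Qed.

Theorem theorem5p9 (n : nat) (hn : (0 < n)%N)
    (omega : {rmorphism symf -> symf})
    (omegaE : forall m : nat, omega (symf_h m) = symf_e m) :
  (-1) ^+ n.-1 *: mobius_sym (path_graph n) = symf_val (omega (PFsym n.-1)).
Proof. by rewrite mobius_sym_path // (omega_PFsym _ omegaE) prednK. Qed.
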